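(* The $\mathcal L_{FS}$-structure $\mathcal M_{\mathsf{VFU}}$ described in the context is a model of $\mathsf{VFU}$.
   Context: $\mathcal L$ is the language of the applicative theory $\mathsf{TON}$ (constants $\mathsf{k},\mathsf{s},\mathsf{p},\mathsf{p}_0,\mathsf{p}_1,\mathsf{0},\mathsf{s}_\mathsf{N},\mathsf{p}_\mathsf{N},\mathsf{d}_\mathsf{N}$, application, predicate $\mathrm N$). $\mathcal L_{FS}$ adds constants $\dot=,\dot\neg,\dot\wedge,\dot\to,\dot\forall,\dot{\mathsf N},\dot{\mathsf T},\mathsf l$ and predicates $\mathrm T,\mathrm U$. Terms $\dot A$: $\dot{(s=t)}:=\dot=(s,t)$, $\dot{\mathrm N(s)}:=\dot{\mathsf N}s$, $\dot{\mathrm T(s)}:=\dot{\mathsf T}s$, $\dot{(\neg A)}:=\dot\neg\dot A$, $\dot{(A\wedge B)}:=\dot\wedge(\dot A,\dot B)$, $\dot{(A\to B)}:=\dot\to(\dot A,\dot B)$, $\dot{(\forall xA)}:=\dot\forall(\lambda x.\dot A)$. $\mathrm C(f):=\forall x(\mathrm T(fx)\vee\mathrm T(\dot\neg(fx)))$; $f\sqsubset g:=\forall x(\mathrm T(fx)\to\mathrm T(g(fx)))\wedge\forall x(\mathrm T(\dot\neg(fx))\to\mathrm T(g(\dot\neg(fx))))$. $\mathsf{VFU}$: $\mathsf{TON}$ and, for $\mathrm U(u)$ and all $\mathcal L_{FS}$-formulas $A,B$: $\mathrm T(u\dot A)\to A$; $P\to\mathrm T(u\dot P)$ for $\mathcal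 L$-literals $P$; $\mathrm T(u\,\dot{(A\to B)})\to(\mathrm T(u\dot A)\to\mathrm T(u\dot B))$; $\forall x\,\mathrm T(u\dot A)\to\mathrm T(u\,\dot{(\forall xA)})$; $\mathrm T(u\dot C)$ for each logically valid $C$; $\neg(\mathrm T(ux)\wedge\mathrm T(u(\dot\neg x)))$; $[\mathrm T(ux)\leftrightarrow\mathrm T(u(\dot{\mathsf T}x))]\wedge[\mathrm T(u(\dot\neg x))\leftrightarrow\mathrm T(u(\dot\neg(\dot{\mathsf T}x)))]$; $\mathrm C(u)$; $\mathrm T(ux)\to\mathrm T(x)$; $\mathrm C(f)\to\mathrm U(\mathsf lf)\wedge f\sqsubset\mathsf lf$. Sequent calculus: add a binary predicate $\mathrm L_x(y)$, with $\dot{\mathrm L_a(b)}:=\mathsf lab$ and $\dot{\neg\mathrm L_a(b)}:=\dot\neg(\mathsf lab)$. Sentences are closed $\mathcal L_{FS}\cup\{\mathrm L\}$-sentences in negation normal form ($\neg$ only on atoms, $\vee,\exists$ primitive, $A\to B$ read as $\neg A\vee B$, $\neg A$ denotes the negation normal form of the negation); closed terms are identified (up to convertibility) with the sentences they code via $A\mapsto\dot A$. A sequent is a finite set of sentences. For ordinals $\alpha,\beta,\gamma$, $\vdash^{\alpha,\beta,\gamma}\Gamma$ is defined by transfinite recursion on $\alpha$ and, for fixed $\alpha$, inductively by the rules: (Lit) $\vdash^{\alpha,\beta,\gamma}\Gamma,P$ for every $\mathcal L$-literal $P$ true in the closed term model $\mathcal{CTT}$; (Log) $\vdash^{\alpha,\beta,\gamma}\Gamma,\mathrm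 T(a),\neg\mathrm T(a)$; ($\wedge$) from $\vdash^{\alpha,\beta,<\gamma}\Gamma,A_0\wedge A_1,A_0$ and $\vdash^{\alpha,\beta,<\gamma}\Gamma,A_0\wedge A_1,A_1$ infer $\vdash^{\alpha,\beta,\gamma}\Gamma,A_0\wedge A_1$; ($\vee_i$) from $\vdash^{\alpha,\beta,<\gamma}\Gamma,A_0\vee A_1,A_i$ infer $\vdash^{\alpha,\beta,\gamma}\Gamma,A_0\vee A_1$; ($\exists$) from $\vdash^{\alpha,\beta,<\gamma}\Gamma,\exists xA(x),A(a)$ infer $\vdash^{\alpha,\beta,\gamma}\Gamma,\exists xA(x)$; ($\forall$) from $\vdash^{\alpha,\beta,<\gamma}\Gamma,\forall xA(x),A(a)$ for all closed terms $a$ infer $\vdash^{\alpha,\beta,\gamma}\Gamma,\forall xA(x)$; ($\mathrm T$) from $\vdash^{\alpha,<\beta,<\gamma}A$ infer $\vdash^{\alpha,\beta,\gamma}\Gamma,\mathrm T(\dot A)$; ($\neg\mathrm T$) from $\vdash^{\alpha,<\beta,<\gamma}\neg A$ infer $\vdash^{\alpha,\beta,\gamma}\Gamma,\neg\mathrm T(\dot A)$; (Weak) from $\vdash^{<\alpha}\Gamma$ infer $\vdash^{\alpha,\beta,\gamma}\Gamma$; ($\mathrm U$) from $\vdash^{<\alpha}b$ infer $\vdash^{\alpha,\beta,\gamma}\Gamma,\mathrm L_a(b)$; ($\neg\mathrm U$) from $\neg\vdash^{<\alpha}b$ infer $\vdash^{\alpha,\beta,\gamma}\Gamma,\neg\mathrm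 L_a(b)$; where ($\mathrm U$),($\neg\mathrm U$) require: $\alpha$ is a successor ordinal, for all closed $c$ $\vdash^{<\alpha}ac$ or $\vdash^{<\alpha}\dot\neg(ac)$, and neither $\vdash^{<\alpha}\mathrm L_a(b)$ nor $\vdash^{<\alpha}\neg\mathrm L_a(b)$. Notation: $\vdash^{\alpha}\Gamma$ means $\vdash^{\alpha,\beta,\gamma}\Gamma$ for some $\beta,\gamma$; $\vdash^{<\alpha}$ means $\vdash^{\alpha_0}$ for some $\alpha_0<\alpha$; $\vdash^{\alpha,\beta,<\gamma}$ means for some $\gamma_0<\gamma$; $\vdash^{\alpha,<\beta,<\gamma}$ for some $\beta_0<\beta,\gamma_0<\gamma$; $\vdash\Gamma$ means $\vdash^\alpha\Gamma$ for some $\alpha$; for a term $b$, $\vdash b$ means $\vdash\{b'\}$ with $b'$ the negation normal form of the sentence coded by $b$ (false if $b$ codes no sentence). $\mathcal M_{\mathsf{VFU}}$: expansion of the closed total term model $\mathcal{CTT}$ (closed terms; constants as themselves; application as juxtaposition; $=$ as convertibility; $\mathrm N(x)$ iff $x$ reduces to a numeral) in which $\mathrm T(x)$ holds iff $\vdash x$, and $\mathrm U(x)$ holds iff $x=\mathsf la$ for some closed term $a$ with $\vdash ac$ or $\vdash\dot\neg(ac)$ for every closed term $c$. *)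

(* Defs.v *)
From Stdlib Require List.
From Stdlib Require Import Relation_Operators Relation_Definitions.
From mathcomp Require Import all_boot.

Set Implicit Arguments.
Unset Strict Implicit.
Unset Printing Implicit Defensive.

(** * Terms *)

(* The last eight are the constants of L_FS that are not in the language of
   TON: the dotted =, not, and, ->, forall, N, T, and the limit constant l. *)
Inductive const : Set :=
  | Ck | Cs | Cp | Cp0 | Cp1 | C0 | CsN | CpN | CdN
  | Ceq | Cneg | Cand | Cimp | Call | CN | CT | Cl.

(* Well-scoped de Bruijn syntax: [V] is the type of free variables, and a
   binder passes from [V] to [option V], [None] being the bound variable. *)
Inductive term (V : Type) : Type :=
  | Var of V
  | Cst of const
  | App of term V & term V.

Arguments Var {V} v.
Arguments Cst {V} c.

Declare Scope app_scope.
Delimit Scope app_scope with app.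
Bind Scope app_scope with term.
Notation "s ∙ t" := (App s t) (at level 39, left associativity) : app_scope.
Local Open Scope app_scope.

Definition closed := term void.

Fixpoint tsubst V W (f : V -> term W) (t : term V) : term W :=
  match t with
  | Var v => f v
  | Cst c => Cst c
  | App a b => tsubst f a ∙ tsubst f b
  end.

Definition shift V (t : term V) : term (option V) :=
  tsubst (fun v => Var (Some v)) t.

Definition up V W (f : V -> term W) : option V -> term (option W) :=
  oapp (fun v => shift (f v)) (Var None).

(* [unshift t = Some t'] iff the bound variable does not occur in [t], and
   then [t = shift t']. *)
Fixpoint unshift V (t : term (option V)) : option (term V) :=
  match t with
  | Var v => omap Var v
  | Cst c => Some (Cst c)
  | App a b =>
      if unshift a is Some a' then omap (App a') (unshift b) else None
  end.

(* lambda x.x := skk; lambda x.t := kt if x does not occur in t; otherwise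
   lambda x.(ab) := s(lambda x.a)(lambda x.b).  The second clause has to cover
   compound t: otherwise abstraction does not commute with substitution. *)
Fixpoint lam V (t : term (option V)) : term V :=
  match t with
  | Var None => Cst Cs ∙ Cst Ck ∙ Cst Ck
  | Var (Some v) => Cst Ck ∙ Var v
  | Cst c => Cst Ck ∙ Cst c
  | App a b =>
      if unshift (a ∙ b) is Some t' then Cst Ck ∙ t'
      else Cst Cs ∙ lam a ∙ lam b
  end.

Definition pair V (s t : term V) : term V := Cst Cp ∙ s ∙ t.

Fixpoint numeral V (n : nat) : term V :=
  if n is m.+1 then Cst CsN ∙ numeral V m else Cst C0.

(** * Reduction and convertibility *)

Inductive step V : term V -> term V -> Prop :=
  | step_k a b : step (Cst Ck ∙ a ∙ b) a
  | step_s a b c : step (Cst Cs ∙ a ∙ b ∙ c) (a ∙ c ∙ (b ∙ c))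
  | step_p0 a b : step (Cst Cp0 ∙ pair a b) a
  | step_p1 a b : step (Cst Cp1 ∙ pair a b) b
  | step_pN n : step (Cst CpN ∙ (Cst CsN ∙ numeral V n)) (numeral V n)
  | step_dN_eq a b n :
      step (Cst CdN ∙ a ∙ b ∙ numeral V n ∙ numeral V n) a
  | step_dN_neq a b m n : m <> n ->
      step (Cst CdN ∙ a ∙ b ∙ numeral V m ∙ numeral V n) b
  | step_appl a a' b : step a a' -> step (a ∙ b) (a' ∙ b)
  | step_appr a b b' : step b b' -> step (a ∙ b) (a ∙ b').

Definition reduces V : relation (term V) := clos_refl_trans _ (@step V).
Definition conv V : relation (term V) := clos_refl_sym_trans _ (@step V).

Definition is_nat V (t : term V) : Prop := exists n, reduces t (numeral V n).

(** * Formulas *)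

(* [ext = false] gives the language L_FS, [ext = true] its extension by the
   binary predicate L; [AL a b] is L_a(b). *)
Inductive atom (ext : bool) (V : Type) : Type :=
  | AEq of term V & term V
  | AN of term V
  | AT of term V
  | AU of term V
  | AL of is_true ext & term V & term V.

Arguments AEq {ext V} s t.
Arguments AN {ext V} t.
Arguments AT {ext V} t.
Arguments AU {ext V} t.

Inductive formula (ext : bool) (V : Type) : Type :=
  | Atom of atom ext V
  | Neg of formula ext V
  | And of formula ext V & formula ext V
  | Imp of formula ext V & formula ext V
  | All of formula ext (option V).

Definition Or ext V (A B : formula ext V) := Neg (And (Neg A) (Neg B)).
Definition Iff ext V (A B : formula ext V) := And (Imp A B) (Imp B A).

Definition Eq V (s t : term V) : formula false V := Atom (AEq s t).
Definition N V (t : term V) : formula false V := Atom (AN t).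
Definition T V (t : term V) : formula false V := Atom (AT t).
Definition U V (t : term V) : formula false V := Atom (AU t).

Definition asubst ext V W (f : V -> term W) (P : atom ext V) : atom ext W :=
  match P with
  | AEq s t => AEq (tsubst f s) (tsubst f t)
  | AN t => AN (tsubst f t)
  | AT t => AT (tsubst f t)
  | AU t => AU (tsubst f t)
  | AL e s t => AL e (tsubst f s) (tsubst f t)
  end.

Fixpoint fsubst ext V W (f : V -> term W) (A : formula ext V) :
    formula ext W :=
  match A with
  | Atom P => Atom (asubst f P)
  | Neg A => Neg (fsubst f A)
  | And A B => And (fsubst f A) (fsubst f B)
  | Imp A B => Imp (fsubst f A) (fsubst f B)
  | All A => All (fsubst (up f) A)
  end.

(* The dotted term of a formula.  There is no dotted U, so formulas in which
   U occurs have no dotted term. *)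
Definition dot_atom ext V (P : atom ext V) : option (term V) :=
  match P with
  | AEq s t => Some (Cst Ceq ∙ pair s t)
  | AN t => Some (Cst CN ∙ t)
  | AT t => Some (Cst CT ∙ t)
  | AU _ => None
  | AL _ a b => Some (Cst Cl ∙ a ∙ b)
  end.

Definition dot2 V (c : const) (a b : option (term V)) : option (term V) :=
  if a is Some a' then omap (fun b' => Cst c ∙ pair a' b') b else None.

Fixpoint dot ext V (A : formula ext V) : option (term V) :=
  match A with
  | Atom P => dot_atom P
  | Neg A => omap (App (Cst Cneg)) (dot A)
  | And A B => dot2 Cand (dot A) (dot B)
  | Imp A B => dot2 Cimp (dot A) (dot B)
  | All A => omap (fun a => Cst Call ∙ lam a) (dot A)
  end.

(** * Structures and logical validity *)

Record structure : Type := Structure {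
  dom :> Type;
  Icst : const -> dom;
  Iapp : dom -> dom -> dom;
  Ieq : dom -> dom -> Prop;
  IN : dom -> Prop;
  IT : dom -> Prop;
  IU : dom -> Prop
}.

(* The identity axioms.  As equality is convertibility in the term model, it
   is interpreted by a congruence rather than by the identity of the domain. *)
Record identity_axioms (M : structure) : Prop := IdentityAxioms {
  Ieq_refl x : @Ieq M x x;
  Ieq_sym x y : @Ieq M x y -> Ieq y x;
  Ieq_trans x y z : @Ieq M x y -> Ieq y z -> Ieq x z;
  Ieq_app x x' y y' : @Ieq M x x' -> Ieq y y' -> Ieq (Iapp x y) (Iapp x' y');
  Ieq_N x y : @Ieq M x y -> IN x -> IN y;
  Ieq_T x y : @Ieq M x y -> IT x -> IT y;
  Ieq_U x y : @Ieq M x y -> IU x -> IU y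
}.

Fixpoint eval (M : structure) V (rho : V -> M) (t : term V) : M :=
  match t with
  | Var v => rho v
  | Cst c => Icst M c
  | App a b => Iapp (eval rho a) (eval rho b)
  end.

Definition sat_atom (M : structure) V (rho : V -> M) (P : atom false V) : Prop :=
  match P with
  | AEq s t => Ieq (eval rho s) (eval rho t)
  | AN t => IN (eval rho t)
  | AT t => IT (eval rho t)
  | AU t => IU (eval rho t)
  | AL e _ _ => match notF e with end
  end.

Fixpoint sat (M : structure) V (rho : V -> M) (A : formula false V) : Prop :=
  match A with
  | Atom P => sat_atom rho P
  | Neg A => ~ sat rho A
  | And A B => sat rho A /\ sat rho B
  | Imp A B => sat rho A -> sat rho B
  | All A => forall d : M, sat (oapp rho d) A
  end.

Definition logically_valid V (A : formula false V) : Prop :=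
  forall M : structure, identity_axioms M -> forall rho : V -> M, sat rho A.

(* Theories are sets of formulas with free variables in [nat], understood as
   universally closed. *)
Definition is_model (M : structure) (Th : formula false nat -> Prop) : Prop :=
  identity_axioms M /\ forall A, Th A -> forall rho : nat -> M, sat rho A.

(** * The theories TON and VFU *)

Definition subst_zero V : option V -> term V := oapp Var (Cst C0).
Definition subst_succ V : option V -> term (option V) :=
  oapp (fun v => Var (Some v)) (Cst CsN ∙ Var None).

Inductive TON : formula false nat -> Prop :=
  | TON_k x y : TON (Eq (Cst Ck ∙ Var x ∙ Var y) (Var x))
  | TON_s x y z :
      TON (Eq (Cst Cs ∙ Var x ∙ Var y ∙ Var z)
              (Var x ∙ Var z ∙ (Var y ∙ Var z)))
  | TON_p x y :
      TON (And (Eq (Cst Cp0 ∙ pair (Var x) (Var y)) (Var x))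
               (Eq (Cst Cp1 ∙ pair (Var x) (Var y)) (Var y)))
  | TON_N x :
      TON (And (N (Cst C0)) (Imp (N (Var x)) (N (Cst CsN ∙ Var x))))
  | TON_sN x :
      TON (Imp (N (Var x))
             (And (Neg (Eq (Cst CsN ∙ Var x) (Cst C0)))
                  (Eq (Cst CpN ∙ (Cst CsN ∙ Var x)) (Var x))))
  | TON_pN x :
      TON (Imp (And (N (Var x)) (Neg (Eq (Var x) (Cst C0))))
             (And (N (Cst CpN ∙ Var x))
                  (Eq (Cst CsN ∙ (Cst CpN ∙ Var x)) (Var x))))
  | TON_dN_eq x y a b :
      TON (Imp (And (N (Var a)) (And (N (Var b)) (Eq (Var a) (Var b))))
             (Eq (Cst CdN ∙ Var x ∙ Var y ∙ Var a ∙ Var b) (Var x)))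
  | TON_dN_neq x y a b :
      TON (Imp (And (N (Var a)) (And (N (Var b)) (Neg (Eq (Var a) (Var b)))))
             (Eq (Cst CdN ∙ Var x ∙ Var y ∙ Var a ∙ Var b) (Var y)))
  | TON_induction (A : formula false (option nat)) :
      TON (Imp (And (fsubst (@subst_zero nat) A)
                    (All (Imp (And (N (Var None)) A)
                              (fsubst (@subst_succ nat) A))))
               (All (Imp (N (Var None)) A))).

Definition total V (f : term V) : formula false V :=
  All (Or (T (shift f ∙ Var None)) (T (Cst Cneg ∙ (shift f ∙ Var None)))).

Definition extends V (f g : term V) : formula false V :=
  let f' := shift f in let g' := shift g in let x := Var None in
  And (All (Imp (T (f' ∙ x)) (T (g' ∙ (f' ∙ x)))))
      (All (Imp (T (Cst Cneg ∙ (f' ∙ x))) (T (g' ∙ (Cst Cneg ∙ (f' ∙ x)))))).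

Definition L_atomic V (P : formula false V) : bool :=
  match P with Atom (AEq _ _) | Atom (AN _) => true | _ => false end.

Definition L_literal V (P : formula false V) : bool :=
  if P is Neg Q then L_atomic Q else L_atomic P.

Inductive VFU : formula false nat -> Prop :=
  | VFU_TON A : TON A -> VFU A
  | VFU_out u (A : formula false nat) a : dot A = Some a ->
      VFU (Imp (U (Var u)) (Imp (T (Var u ∙ a)) A))
  | VFU_lit u (P : formula false nat) p : L_literal P -> dot P = Some p ->
      VFU (Imp (U (Var u)) (Imp P (T (Var u ∙ p))))
  | VFU_imp u (A B : formula false nat) a b i :
      dot A = Some a -> dot B = Some b -> dot (Imp A B) = Some i ->
      VFU (Imp (U (Var u))
             (Imp (T (Var u ∙ i)) (Imp (T (Var u ∙ a)) (T (Var u ∙ b)))))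
  | VFU_all u (A : formula false (option nat)) a q : dot A = Some a -> dot (All A) = Some q ->
      VFU (Imp (U (Var u))
             (Imp (All (T (Var (Some u) ∙ a))) (T (Var u ∙ q))))
  | VFU_log u (C : formula false nat) c : logically_valid C -> dot C = Some c ->
      VFU (Imp (U (Var u)) (T (Var u ∙ c)))
  | VFU_cons u x :
      VFU (Imp (U (Var u))
             (Neg (And (T (Var u ∙ Var x)) (T (Var u ∙ (Cst Cneg ∙ Var x))))))
  | VFU_T u x :
      VFU (Imp (U (Var u))
             (And (Iff (T (Var u ∙ Var x)) (T (Var u ∙ (Cst CT ∙ Var x))))
                  (Iff (T (Var u ∙ (Cst Cneg ∙ Var x)))
                       (T (Var u ∙ (Cst Cneg ∙ (Cst CT ∙ Var x)))))))
  | VFU_total u : VFU (Imp (U (Var u)) (total (Var u)))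
  | VFU_sound u x :
      VFU (Imp (U (Var u)) (Imp (T (Var u ∙ Var x)) (T (Var x))))
  | VFU_lim f :
      VFU (Imp (total (Var f))
             (And (U (Cst Cl ∙ Var f)) (extends (Var f) (Cst Cl ∙ Var f)))).

(** * Ordinals *)

(* Well-founded trees: [osup f] is the least ordinal strictly above every
   [f i].  Distinct trees may denote the same ordinal; only the comparisons
   below are used. *)
Inductive ord : Type := osup (I : Type) of (I -> ord).

Fixpoint ole (a b : ord) : Prop :=
  match a, b with
  | osup X f, osup Y g => forall i : X, exists j : Y, ole (f i) (g j)
  end.

Definition olt (a b : ord) : Prop :=
  match b with osup Y g => exists j : Y, ole a (g j) end.

Definition osucc (a : ord) : ord := osup (fun _ : unit => a).

Definition is_succ (a : ord) : Prop :=
  exists b, ole a (osucc b) /\ ole (osucc b) a.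

Lemma ole_trans a b c : ole a b -> ole b c -> ole a c.
Proof.
elim: a b c => I f IH [J g] [K h] /= Hab Hbc i.
have [j Hj] := Hab i; have [k Hk] := Hbc j.
by exists k; apply: IH Hj Hk.
Qed.

Lemma olt_wf : well_founded olt.
Proof.
suff H b a : ole a b -> Acc olt a.
  move=> b; constructor=> a; case: b => J g [j]; exact: H.
elim: b a => J g IH [I f] Hab; constructor=> c [i Hc].
have [j Hj] := Hab i.
exact: IH j c (ole_trans Hc Hj).
Qed.

(** * The sequent calculus *)

Inductive nf (V : Type) : Type :=
  | Lit of bool & atom true V
  | Conj of nf V & nf V
  | Disj of nf V & nf V
  | Univ of nf (option V)
  | Exis of nf (option V).

Fixpoint nsubst V W (f : V -> term W) (A : nf V) : nf W :=
  match A with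
  | Lit s P => Lit s (asubst f P)
  | Conj A B => Conj (nsubst f A) (nsubst f B)
  | Disj A B => Disj (nsubst f A) (nsubst f B)
  | Univ A => Univ (nsubst (up f) A)
  | Exis A => Exis (nsubst (up f) A)
  end.

Definition inst (A : nf (option void)) (c : closed) : nf void :=
  nsubst (oapp Var c) A.

(* Negation normal form of [A] (for [pos = true]) or of its negation. *)
Fixpoint nnf (pos : bool) V (A : formula true V) : nf V :=
  match A with
  | Atom P => Lit pos P
  | Neg A => nnf (~~ pos) A
  | And A B =>
      if pos then Conj (nnf true A) (nnf true B)
      else Disj (nnf false A) (nnf false B)
  | Imp A B =>
      if pos then Disj (nnf false A) (nnf true B)
      else Conj (nnf true A) (nnf false B)
  | All A => if pos then Univ (nnf true A) else Exis (nnf false A)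
  end.

Inductive aconv ext V : atom ext V -> atom ext V -> Prop :=
  | aconv_Eq s s' t t' : conv s s' -> conv t t' ->
      aconv (AEq s t) (AEq s' t')
  | aconv_N t t' : conv t t' -> aconv (AN t) (AN t')
  | aconv_T t t' : conv t t' -> aconv (AT t) (AT t')
  | aconv_U t t' : conv t t' -> aconv (AU t) (AU t')
  | aconv_L e e' s s' t t' : conv s s' -> conv t t' ->
      aconv (AL e s t) (AL e' s' t').

Inductive nconv : forall V, nf V -> nf V -> Prop :=
  | nconv_Lit V b (P Q : atom true V) : aconv P Q -> nconv (Lit b P) (Lit b Q)
  | nconv_Conj V (A A' B B' : nf V) :
      nconv A A' -> nconv B B' -> nconv (Conj A B) (Conj A' B')
  | nconv_Disj V (A A' B B' : nf V) :
      nconv A A' -> nconv B B' -> nconv (Disj A B) (Disj A' B')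
  | nconv_Univ V (A A' : nf (option V)) :
      nconv A A' -> nconv (Univ A) (Univ A')
  | nconv_Exis V (A A' : nf (option V)) :
      nconv A A' -> nconv (Exis A) (Exis A').

(* A list stands for the finite set of its elements, sentences being
   identified up to convertibility. *)
Definition sequent := seq (nf void).

Definition mem (A : nf void) (G : sequent) : Prop :=
  exists2 B, List.In B G & nconv A B.

Definition pos_lit (P : atom true void) : nf void := Lit true P.
Definition neg_lit (P : atom true void) : nf void := Lit false P.
Definition Lat (a b : closed) : atom true void := AL (isT : is_true true) a b.

Definition codes (t : closed) (A : formula true void) : Prop :=
  exists2 a, dot A = Some a & conv t a.

Definition on_term (D : sequent -> Prop) (t : closed) : Prop :=
  exists2 A, codes t A & D [:: nnf true A].

Definition decided (D : sequent -> Prop) (a : closed) : Prop :=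
  forall c : closed, on_term D (a ∙ c) \/ on_term D (Cst Cneg ∙ (a ∙ c)).

Definition CTT_true (pos : bool) (P : atom true void) : Prop :=
  match P with
  | AEq s t => if pos then conv s t else ~ conv s t
  | AN t => if pos then is_nat t else ~ is_nat t
  | _ => False
  end.

(* One stage alpha of the calculus: [prev] is derivability at some earlier
   stage and [succ] says that alpha is a successor.  The principal formula of a
   rule belongs to its conclusion [G], hence also to the premises [A :: G]. *)
Inductive stage (prev : sequent -> Prop) (succ : Prop) :
    ord -> ord -> sequent -> Prop :=
  | R_Lit beta gamma G pos P :
      CTT_true pos P -> mem (Lit pos P) G ->
      stage prev succ beta gamma G
  | R_Log beta gamma G a :
      mem (pos_lit (AT a)) G -> mem (neg_lit (AT a)) G ->
      stage prev succ beta gamma G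
  | R_Conj beta gamma gamma0 gamma1 G A0 A1 :
      mem (Conj A0 A1) G ->
      olt gamma0 gamma -> stage prev succ beta gamma0 (A0 :: G) ->
      olt gamma1 gamma -> stage prev succ beta gamma1 (A1 :: G) ->
      stage prev succ beta gamma G
  | R_Disj0 beta gamma gamma0 G A0 A1 :
      mem (Disj A0 A1) G ->
      olt gamma0 gamma -> stage prev succ beta gamma0 (A0 :: G) ->
      stage prev succ beta gamma G
  | R_Disj1 beta gamma gamma0 G A0 A1 :
      mem (Disj A0 A1) G ->
      olt gamma0 gamma -> stage prev succ beta gamma0 (A1 :: G) ->
      stage prev succ beta gamma G
  | R_Exis beta gamma gamma0 G A a :
      mem (Exis A) G ->
      olt gamma0 gamma -> stage prev succ beta gamma0 (inst A a :: G) ->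
      stage prev succ beta gamma G
  | R_Univ beta gamma (gamma0 : closed -> ord) G A :
      mem (Univ A) G ->
      (forall a, olt (gamma0 a) gamma) ->
      (forall a, stage prev succ beta (gamma0 a) (inst A a :: G)) ->
      stage prev succ beta gamma G
  | R_T beta gamma beta0 gamma0 G t A :
      mem (pos_lit (AT t)) G -> codes t A ->
      olt beta0 beta -> olt gamma0 gamma ->
      stage prev succ beta0 gamma0 [:: nnf true A] ->
      stage prev succ beta gamma G
  | R_negT beta gamma beta0 gamma0 G t A :
      mem (neg_lit (AT t)) G -> codes t A ->
      olt beta0 beta -> olt gamma0 gamma ->
      stage prev succ beta0 gamma0 [:: nnf false A] ->
      stage prev succ beta gamma G
  | R_Weak beta gamma G :
      prev G -> stage prev succ beta gamma G
  | R_U beta gamma G a b :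
      succ -> decided prev a ->
      ~ prev [:: pos_lit (Lat a b)] -> ~ prev [:: neg_lit (Lat a b)] ->
      on_term prev b -> mem (pos_lit (Lat a b)) G ->
      stage prev succ beta gamma G
  | R_negU beta gamma G a b :
      succ -> decided prev a ->
      ~ prev [:: pos_lit (Lat a b)] -> ~ prev [:: neg_lit (Lat a b)] ->
      ~ on_term prev b -> mem (neg_lit (Lat a b)) G ->
      stage prev succ beta gamma G.

Definition derives : ord -> ord -> ord -> sequent -> Prop :=
  Fix olt_wf (fun _ => ord -> ord -> sequent -> Prop)
    (fun alpha rec =>
       stage
         (fun G => exists alpha0 (lt0 : olt alpha0 alpha) beta gamma,
            rec alpha0 lt0 beta gamma G)
         (is_succ alpha)).

Definition derivable (G : sequent) : Prop :=
  exists alpha beta gamma, derives alpha beta gamma G.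

(** * The structure M_VFU *)

Definition M_VFU : structure := {|
  dom := closed;
  Icst := @Cst void;
  Iapp := @App void;
  Ieq := @conv void;
  IN := @is_nat void;
  IT := on_term derivable;
  IU := fun x => exists2 a, conv x (Cst Cl ∙ a) & decided derivable a
|}.

(* Main.v *)
(* The axioms of VFU for a universe [u = l a] are reflected into one stage of the
   calculus.  If the class [a] is decided, all literals [L_a(b)] become decided
   at the same stage, the least successor stage [beta + 1] such that [a] is
   decided at [beta]; hence [T (u x)] holds in the model iff [x] is derivable at
   stage [beta].  It remains to see that derivability at a fixed stage is closed
   under the axioms.  Rather than eliminating cuts, we use that a stage is the
   cut-free omega-logic over its own derivable literals, and that this logic is
   sound and complete for the valuations extending these literals in which T is
   two-valued.  Modus ponens and the derivability of logical truths follow at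
   once; so does consistency, by induction on the stage and on the rank beta,
   because a derivable [T t] or [~ T t] comes from a smaller derivation of the
   sentence coded by [t] or of its negation.  The Church-Rosser theorem makes the
   coded sentence unique up to convertibility. *)

From Stdlib Require Import Classical ClassicalEpsilon.
From Stdlib Require Import FunctionalExtensionality PropExtensionality.
From Stdlib Require Import Relation_Operators.
From mathcomp Require Import all_boot zify.
Require Import Defs.

Set Implicit Arguments.
Unset Strict Implicit.
Unset Printing Implicit Defensive.

Local Open Scope app_scope.

(** * Confluence *)

(** Parallel reduction in the style of Tait and Martin-Löf. No reduct is recorded for an argument
    that the contraction discards, nor for a numeral, which is normal. *)
Inductive par V : term V -> term V -> Prop :=
  | par_var v : par (Var v) (Var v)
  | par_cst c : par (Cst c) (Cst c)
  | par_app a a' b b' : par a a' -> par b b' -> par (a ∙ b) (a' ∙ b')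
  | par_k a a' b : par a a' -> par (Cst Ck ∙ a ∙ b) a'
  | par_s a a' b b' c c' : par a a' -> par b b' -> par c c' ->
      par (Cst Cs ∙ a ∙ b ∙ c) (a' ∙ c' ∙ (b' ∙ c'))
  | par_p0 a a' b : par a a' -> par (Cst Cp0 ∙ pair a b) a'
  | par_p1 a b b' : par b b' -> par (Cst Cp1 ∙ pair a b) b'
  | par_pN n : par (Cst CpN ∙ (Cst CsN ∙ numeral V n)) (numeral V n)
  | par_dN_eq a a' b n : par a a' ->
      par (Cst CdN ∙ a ∙ b ∙ numeral V n ∙ numeral V n) a'
  | par_dN_neq a b b' m n : m <> n -> par b b' ->
      par (Cst CdN ∙ a ∙ b ∙ numeral V m ∙ numeral V n) b'.

Lemma par_refl V (t : term V) : par t t.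
Proof. by elim: t => *; constructor. Qed.
#[local] Hint Resolve par_refl : core.

Lemma numeral_inj V : injective (numeral V).
Proof. by elim=> [|n IH] [|m] //= [/IH ->]. Qed.

Lemma step_par V (t u : term V) : step t u -> par t u.
Proof. by elim=> *; constructor. Qed.

Lemma reduces_app V (a a' b b' : term V) :
  reduces a a' -> reduces b b' -> reduces (a ∙ b) (a' ∙ b').
Proof.
move=> Ha Hb; apply: (rt_trans _ _ _ (a' ∙ b)).
  elim: Ha => [x y xy|x|x y z _ IH1 _ IH2]; [|exact: rt_refl|exact: rt_trans IH1 IH2].
  by apply: rt_step; constructor.
elim: Hb => [x y xy|x|x y z _ IH1 _ IH2]; [|exact: rt_refl|exact: rt_trans IH1 IH2].
by apply: rt_step; constructor.
Qed.

Lemma par_reduces V (t u : term V) : par t u -> reduces t u.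
Proof.
have R x y z : @step V x y -> reduces y z -> reduces x z.
  by move=> xy; apply: rt_trans; apply: rt_step.
elim=> *; try exact: rt_refl; try exact: reduces_app;
  try by apply: R; first by constructor.
- by apply: R; [constructor|do 2!apply: reduces_app].
- by apply: R; [exact: step_pN|exact: rt_refl].
Qed.

Lemma par_cst_inv V c (u : term V) : par (Cst c) u -> u = Cst c.
Proof. by move=> H; inversion H. Qed.

Lemma par_numeral V n (u : term V) : par (numeral V n) u -> u = numeral V n.
Proof.
elim: n u => [|n IH] u /= H; first exact: par_cst_inv.
inversion H; subst.
by rewrite (par_cst_inv H2) (IH _ H4).
Qed.

(* The constants that are not the head of a redex. *)
Definition inert (c : const) : bool :=
  match c with
  | Ck | Cs | Cp0 | Cp1 | CpN | CdN => false
  | _ => true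
  end.

Lemma par_inert1 V c (s u : term V) : inert c -> par (Cst c ∙ s) u ->
  exists2 s', u = Cst c ∙ s' & par s s'.
Proof.
move=> ic H; inversion H; subst => //; rewrite ?(par_cst_inv H2).
by exists b'.
Qed.

Lemma par_inert2 V c (s t u : term V) : inert c -> par (Cst c ∙ s ∙ t) u ->
  exists s' t', [/\ u = Cst c ∙ s' ∙ t', par s s' & par t t'].
Proof.
move=> ic H; inversion H; subst => //.
by have [s' -> ss'] := par_inert1 ic H2; exists s', b'.
Qed.

(** Below its full number of arguments such a constant forms no redex at the head, so reduction
    stays inside the arguments. *)
Lemma par_partial1 V c (s u : term V) : c = Ck \/ c = Cs \/ c = CdN ->
  par (Cst c ∙ s) u -> exists2 s', u = Cst c ∙ s' & par s s'.
Proof.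
move=> ic H; inversion H; subst; try (by case: ic => [//|[]//]).
by rewrite (par_cst_inv H2); exists b'.
Qed.

Lemma par_partial2 V c (s t u : term V) : c = Cs \/ c = CdN ->
  par (Cst c ∙ s ∙ t) u ->
  exists s' t', [/\ u = Cst c ∙ s' ∙ t', par s s' & par t t'].
Proof.
move=> ic H; inversion H; subst; try (by case: ic => []//).
have [|s' -> ss'] := par_partial1 _ H2; first by case: ic; auto.
by exists s', b'.
Qed.

Lemma par_dN3 V (a b : term V) n u : par (Cst CdN ∙ a ∙ b ∙ numeral V n) u ->
  exists a' b', [/\ u = Cst CdN ∙ a' ∙ b' ∙ numeral V n, par a a' & par b b'].
Proof.
move=> H; inversion H; subst.
have [|a1 [b1 [-> aa1 bb1]]] := par_partial2 _ H2; first by auto.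
by rewrite (par_numeral H4); exists a1, b1.
Qed.

Fixpoint tsize V (t : term V) : nat :=
  if t is a ∙ b then (tsize a + tsize b).+1 else 0.

(* The witness is Takahashi's complete development of [t]. *)
Lemma triangle V (t : term V) : exists s, forall u, par t u -> par u s.
Proof.
have [n] := ubnP (tsize t); elim: n t => // n IH [v|c|a b] lt_n.
- by exists (Var v) => u H; inversion H; subst.
- by exists (Cst c) => u H; inversion H; subst.
(* The six splits single out the redex shapes one by one. For a redex the witness is its contractum
   with developed parts; the componentwise witness remains for the case in which all six shapes are
   refuted. *)
case: (classic (exists x, a = Cst Ck ∙ x)) => [[x ?]|nk].
  subst; have [|x' Hx] := IH x; first by move: lt_n => /=; lia.
  exists x' => u H; inversion H; subst; last exact: Hx.
  by have [|y -> xy] := par_partial1 _ H2; [auto|constructor; apply: Hx].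
case: (classic (exists x y, a = Cst Cs ∙ x ∙ y)) => [[x [y ?]]|ns].
  subst; have [|x' Hx] := IH x; first by move: lt_n => /=; lia.
  have [|y' Hy] := IH y; first by move: lt_n => /=; lia.
  have [|z' Hz] := IH b; first by move: lt_n => /=; lia.
  exists (x' ∙ z' ∙ (y' ∙ z')) => u H; inversion H; subst.
    have [|x1 [y1 [-> xx yy]]] := par_partial2 _ H2; first by auto.
    by constructor; auto.
  by do 2!constructor; auto.
case: (classic (exists x y, a = Cst Cp0 /\ b = pair x y)) => [[x [y [? ?]]]|n0].
  subst; have [|x' Hx] := IH x; first by move: lt_n => /=; lia.
  exists x' => u H; inversion H; subst; last exact: Hx.
  rewrite (par_cst_inv H2).
  by have [|x1 [y1 [-> xx yy]]] := par_inert2 _ H4; [|constructor; apply: Hx].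
case: (classic (exists x y, a = Cst Cp1 /\ b = pair x y)) => [[x [y [? ?]]]|n1].
  subst; have [|x' Hx] := IH y; first by move: lt_n => /=; lia.
  exists x' => u H; inversion H; subst; last exact: Hx.
  rewrite (par_cst_inv H2).
  by have [|x1 [y1 [-> xx yy]]] := par_inert2 _ H4; [|constructor; apply: Hx].
case: (classic (exists m, a = Cst CpN /\ b = Cst CsN ∙ numeral V m)) => [[m [? ?]]|nN].
  subst; exists (numeral V m) => u H; inversion H; subst.
    by rewrite (par_cst_inv H2) (@par_numeral _ m.+1 _ H4); constructor.
  by move/numeral_inj: H1 => ->.
case: (classic (exists x y m p, a = Cst CdN ∙ x ∙ y ∙ numeral V m /\ b = numeral V p))
  => [[x [y [m [p [? ?]]]]]|nd].
  subst; have [|x' Hx] := IH x; first by move: lt_n => /=; lia.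
  have [|y' Hy] := IH y; first by move: lt_n => /=; lia.
  have [?|/eqP neq] := eqVneq m p.
    subst p; exists x' => u H; inversion H; subst.
    - have [x1 [y1 [-> xx yy]]] := par_dN3 H2; rewrite (par_numeral H4).
      by constructor; apply: Hx.
    - exact: Hx.
    - by case: H5; apply: (@numeral_inj V); congruence.
  exists y' => u H; inversion H; subst.
  - have [x1 [y1 [-> xx yy]]] := par_dN3 H2; rewrite (par_numeral H4).
    by constructor; [|apply: Hy].
  - by case: neq; apply: (@numeral_inj V); congruence.
  - exact: Hy.
have [|a' Ha] := IH a; first by move: lt_n => /=; lia.
have [|b' Hb] := IH b; first by move: lt_n => /=; lia.
exists (a' ∙ b') => u H; inversion H; subst; first by constructor; auto.
all: exfalso.
- by apply: nk; eexists.
- by apply: ns; do 2!eexists.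
- by apply: n0; do 2!eexists.
- by apply: n1; do 2!eexists.
- by apply: nN; eexists.
- by apply: nd; do 4!eexists.
- by apply: nd; do 4!eexists.
Qed.

Definition joinable V (s t : term V) : Prop :=
  exists2 w, reduces s w & reduces t w.

(** The strip lemma: the reduction is cut into single steps, each of them a parallel step, and
    [triangle] closes every tile while the other side remains one parallel step. *)
Lemma par_join_reduces V (s t u : term V) : par s t -> reduces s u ->
  exists2 w, reduces t w & par u w.
Proof.
move=> st su; elim: su t st => {s u} [x y /step_par xy|x|x y z _ IH1 _ IH2] t xt.
- by have [w Hw] := triangle x; exists w; [apply: par_reduces|]; apply: Hw.
- by exists t => //; apply: rt_refl.
- have [w tw yw] := IH1 _ xt; have [w' ww' zw'] := IH2 _ yw.
  by exists w' => //; apply: rt_trans tw ww'.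
Qed.

Lemma reduces_confluent V (s t u : term V) :
  reduces s t -> reduces s u -> joinable t u.
Proof.
move=> st; elim: st u => {s t} [x y /step_par xy|x|x y z _ IH1 _ IH2] u xu.
- have [w yw uw] := par_join_reduces xy xu.
  by exists w => //; apply: par_reduces.
- by exists u => //; apply: rt_refl.
- have [w yw uw] := IH1 _ xu; have [w' zw' ww'] := IH2 _ yw.
  by exists w' => //; apply: rt_trans uw ww'.
Qed.

Lemma church_rosser V (s t : term V) : conv s t -> joinable s t.
Proof.
elim=> {s t} [x y xy|x|x y _ [w xw yw]|x y z _ [w xw yw] _ [w' yw' zw']].
- by exists y; [apply: rt_step|apply: rt_refl].
- by exists x; apply: rt_refl.
- by exists w.
- have [w'' ww'' w'w''] := reduces_confluent yw yw'.
  by exists w''; [apply: rt_trans xw ww''|apply: rt_trans zw' w'w''].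
Qed.

Lemma conv_refl V (t : term V) : conv t t. Proof. exact: rst_refl. Qed.
#[local] Hint Resolve conv_refl : core.
Lemma conv_sym V (s t : term V) : conv s t -> conv t s.
Proof. exact: rst_sym. Qed.
Lemma conv_trans V (s t u : term V) : conv s t -> conv t u -> conv s u.
Proof. exact: rst_trans. Qed.

Lemma reduces_conv V (s t : term V) : reduces s t -> conv s t.
Proof.
by elim=> *; [apply: rst_step|apply: rst_refl|apply: rst_trans; eassumption].
Qed.

Lemma step_conv V (s t : term V) : step s t -> conv s t.
Proof. exact: rst_step. Qed.

Lemma conv_app V (a a' b b' : term V) :
  conv a a' -> conv b b' -> conv (a ∙ b) (a' ∙ b').
Proof.
move=> /church_rosser [x ax a'x] /church_rosser [y b_y b'y].
apply: conv_trans (reduces_conv (reduces_app ax b_y)) _.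
by apply: conv_sym; apply: reduces_conv; apply: reduces_app.
Qed.

Lemma reduces_numeral V n (u : term V) :
  reduces (numeral V n) u -> u = numeral V n.
Proof.
move E: (numeral V n) => t tu.
elim: tu n E => {t u} [x y /step_par xy|//|x y z _ IH1 _ IH2] n E.
  by subst; apply: par_numeral.
by move/IH1: (E) => ?; subst y; move/IH2: E.
Qed.

(** A numeral is normal, so its only common reduct with a convertible term is the numeral itself. *)
Lemma is_nat_conv V (s t : term V) : conv s t -> is_nat s -> is_nat t.
Proof.
move=> st [n sn]; exists n.
have /church_rosser [w tw nw] : conv t (numeral V n).
  by apply: conv_trans (conv_sym st) (reduces_conv sn).
by rewrite -(reduces_numeral nw).
Qed.

Lemma conv_numeral V m n : conv (numeral V m) (numeral V n) -> m = n.
Proof.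
move=> /church_rosser [w /reduces_numeral-> /reduces_numeral].
exact: numeral_inj.
Qed.

Lemma reduces_inert1 V c (s u : term V) : inert c -> reduces (Cst c ∙ s) u ->
  exists2 s', u = Cst c ∙ s' & reduces s s'.
Proof.
move=> ic; move E: (Cst c ∙ s) => t tu.
elim: tu s E => {t u} [x y /step_par xy|x|x y z _ IH1 _ IH2] s E; subst.
- by have [s' -> ss'] := par_inert1 ic xy; exists s' => //; apply: par_reduces.
- by exists s => //; apply: rt_refl.
- have [s1 ? ss1] := IH1 _ erefl; subst y; have [s2 -> ss2] := IH2 _ erefl.
  by exists s2 => //; apply: rt_trans ss1 ss2.
Qed.

Lemma reduces_inert2 V c (s t u : term V) : inert c ->
  reduces (Cst c ∙ s ∙ t) u ->
  exists s' t', [/\ u = Cst c ∙ s' ∙ t', reduces s s' & reduces t t'].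
Proof.
move=> ic; move E: (Cst c ∙ s ∙ t) => r ru.
elim: ru s t E => {r u} [x y /step_par xy|x|x y z _ IH1 _ IH2] s t E; subst.
- have [s' [t' [-> ss' tt']]] := par_inert2 ic xy.
  by exists s', t'; split=> //; apply: par_reduces.
- by exists s, t; split=> //; apply: rt_refl.
- have [s1 [t1 [? ss1 tt1]]] := IH1 _ _ erefl; subst y.
  have [s2 [t2 [-> ss2 tt2]]] := IH2 _ _ erefl.
  by exists s2, t2; split=> //; [apply: rt_trans ss1 ss2|apply: rt_trans tt1 tt2].
Qed.

Lemma joinable_conv V (s t : term V) : joinable s t -> conv s t.
Proof.
move=> [w sw tw]; apply: conv_trans (reduces_conv sw) _.
exact: conv_sym (reduces_conv tw).
Qed.

(** Inert heads behave like free constructors: reduction stays inside the arguments, so a common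
    reduct displays both heads. Unique readability of coded sentences rests on this. *)
Lemma conv_inert1 V c d (s t : term V) : conv (Cst c ∙ s) (Cst d ∙ t) ->
  inert c -> inert d -> c = d /\ conv s t.
Proof.
move=> H ic id; move: H => /church_rosser [w /(reduces_inert1 ic) [s' -> ss']].
move=> /(reduces_inert1 id) [t' [? ?] tt']; subst.
by split=> //; apply: joinable_conv; exists t'.
Qed.

Lemma conv_inert2 V c d (s s' t t' : term V) : conv (Cst c ∙ s ∙ t) (Cst d ∙ s' ∙ t') ->
  inert c -> inert d -> [/\ c = d, conv s s' & conv t t'].
Proof.
move=> H ic id; move: H => /church_rosser [w /(reduces_inert2 ic) [x [y [-> sx ty]]]].
move=> /(reduces_inert2 id) [x' [y' [[? ? ?] sx' ty']]]; subst.
by split=> //; apply: joinable_conv; [exists x'|exists y'].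
Qed.

Lemma conv_inert12 V c d (s s' t' : term V) : conv (Cst c ∙ s) (Cst d ∙ s' ∙ t') ->
  inert c -> inert d -> False.
Proof.
move=> H ic id; move: H => /church_rosser [w /(reduces_inert1 ic) [x -> _]].
by move=> /(reduces_inert2 id) [x' [y' []]].
Qed.

(** * Substitution and coding *)

Lemma tsubst_comp V W X (f : V -> term W) (g : W -> term X) t :
  tsubst g (tsubst f t) = tsubst (fun v => tsubst g (f v)) t.
Proof. by elim: t => //= a -> b ->. Qed.

Lemma tsubst_shift V W (f : option V -> term W) t :
  tsubst f (shift t) = tsubst (fun v => f (Some v)) t.
Proof. by rewrite /shift tsubst_comp. Qed.

Lemma tsubst_Var V (t : term V) : tsubst Var t = t.
Proof. by elim: t => //= a -> b ->. Qed.

Lemma shift_tsubst V W (f : V -> term W) t :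
  shift (tsubst f t) = tsubst (up f) (shift t).
Proof. by rewrite tsubst_shift /shift tsubst_comp. Qed.

Lemma tsubst_numeral V W (f : V -> term W) n :
  tsubst f (numeral V n) = numeral W n.
Proof. by elim: n => //= n ->. Qed.

Lemma step_tsubst V W (f : V -> term W) s t :
  step s t -> step (tsubst f s) (tsubst f t).
Proof. by elim=> *; rewrite /= ?tsubst_numeral; constructor. Qed.

Lemma conv_tsubst V W (f : V -> term W) s t :
  conv s t -> conv (tsubst f s) (tsubst f t).
Proof.
elim=> {s t} [s t /(step_tsubst f)/step_conv//|//|s t _ /conv_sym//|s t u _ + _].
exact: conv_trans.
Qed.

Lemma unshift_Some V (t : term (option V)) t' :
  unshift t = Some t' -> t = shift t'.
Proof.
elim: t t' => [[v|]|c|a IHa b IHb] t' //=; try by case=> <-.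
case: unshift IHa => // a' /(_ _ erefl) ->.
by case: unshift IHb => // b' /(_ _ erefl) -> [<-].
Qed.

Lemma unshift_shift V (t : term V) : unshift (shift t) = Some t.
Proof. by elim: t => //= a -> b ->. Qed.

Lemma unshift_up V W (f : V -> term W) t :
  unshift (tsubst (up f) t) = omap (tsubst f) (unshift t).
Proof.
elim: t => [[v|]|c|a IHa b IHb] //=; first exact: unshift_shift.
by rewrite IHa; case: unshift => //= a'; rewrite IHb; case: unshift.
Qed.

Lemma lam_shift V (t : term V) : lam (shift t) = Cst Ck ∙ t.
Proof. by case: t => //= a b; rewrite !unshift_shift. Qed.

(** The substitution [up f] neither removes nor introduces an occurrence of the bound variable, so
    both sides take the same clause of [lam]. *)
Lemma lam_tsubst V W (f : V -> term W) t :
  lam (tsubst (up f) t) = tsubst f (lam t).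
Proof.
elim: t => [[v|]|c|a IHa b IHb] //; first exact: lam_shift.
rewrite /= !unshift_up; case: (unshift a) (unshift b) => [a'|] [b'|] //=;
  by rewrite IHa IHb.
Qed.

Lemma lam_beta V (t : term (option V)) : conv (shift (lam t) ∙ Var None) t.
Proof.
elim: t => [[v|]|c|a IHa b IHb].
- exact/step_conv/step_k.
- exact: conv_trans (step_conv (step_s _ _ _)) (step_conv (step_k _ _)).
- exact/step_conv/step_k.
- rewrite /lam -/lam; case E: unshift => [t'|].
    by rewrite (unshift_Some E); apply/step_conv/step_k.
  by apply: conv_trans (step_conv (step_s _ _ _)) _; apply: conv_app.
Qed.

(** Combinatory conversion has no rule that passes under [lam], but the converse direction holds:
    applying both abstractions to a fresh variable undoes them. Codes of quantified formulas are
    compared in this way. *)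
Lemma conv_lam V (s t : term (option V)) : conv (lam s) (lam t) -> conv s t.
Proof.
move=> /(conv_tsubst (fun v => Var (Some v))) st.
apply: conv_trans (conv_sym (lam_beta s)) (conv_trans _ (lam_beta t)).
exact: conv_app.
Qed.

(* Formulas restricted to scopes in [Set], as [dot] and [nnf] are: the
   generated eliminators live in a larger universe. *)
Lemma formula_set_ind ext (P : forall V : Set, formula ext V -> Prop)
  (PAtom : forall (V : Set) (Q : atom ext V), P V (Atom Q))
  (PNeg : forall (V : Set) (A : formula ext V), P V A -> P V (Neg A))
  (PAnd : forall (V : Set) (A : formula ext V), P V A ->
     forall B, P V B -> P V (And A B))
  (PImp : forall (V : Set) (A : formula ext V), P V A ->
     forall B, P V B -> P V (Imp A B))
  (PAll : forall (V : Set) (A : formula ext (option V)), P _ A -> P V (All A))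
  (V : Set) (A : formula ext V) : P V A.
Proof.
move: V A; fix IH 2 => V [Q|A|A B|A B|A];
  [exact: PAtom|apply: PNeg|apply: PAnd|apply: PImp|apply: PAll]; exact: IH.
Qed.

Lemma nf_set_ind (P : forall V : Set, nf V -> Prop)
  (PLit : forall (V : Set) b (Q : atom true V), P V (Lit b Q))
  (PConj : forall (V : Set) (A : nf V), P V A ->
     forall B, P V B -> P V (Conj A B))
  (PDisj : forall (V : Set) (A : nf V), P V A ->
     forall B, P V B -> P V (Disj A B))
  (PUniv : forall (V : Set) (A : nf (option V)), P _ A -> P V (Univ A))
  (PExis : forall (V : Set) (A : nf (option V)), P _ A -> P V (Exis A))
  (V : Set) (A : nf V) : P V A.
Proof.
move: V A; fix IH 2 => V [b Q|A B|A B|A|A];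
  [exact: PLit|apply: PConj|apply: PDisj|apply: PUniv|apply: PExis]; exact: IH.
Qed.

Lemma dot_fsubst ext (V W : Set) (f : V -> term W) (A : formula ext V) :
  dot (fsubst f A) = omap (tsubst f) (dot A).
Proof.
elim/formula_set_ind: A W f => {V} [V P|V A IH|V A IHA B IHB|V A IHA B IHB|V A IH] W f /=.
- by case: P.
- by rewrite IH; case: dot.
- by rewrite IHA IHB; case: dot => //= a; case: dot.
- by rewrite IHA IHB; case: dot => //= a; case: dot.
- by rewrite IH; case: dot => //= a; rewrite lam_tsubst.
Qed.

Lemma asubst_comp ext V W X (f : V -> term W) (g : W -> term X)
    (P : atom ext V) :
  asubst g (asubst f P) = asubst (fun v => tsubst g (f v)) P.
Proof. by case: P => * /=; rewrite !tsubst_comp. Qed.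

Lemma asubst_Var ext V (P : atom ext V) : asubst Var P = P.
Proof. by case: P => * /=; rewrite !tsubst_Var. Qed.

Lemma nsubst_ext (V W : Set) (f g : V -> term W) A : f =1 g -> nsubst f A = nsubst g A.
Proof. by move/functional_extensionality => ->. Qed.

Lemma up_comp V W X (f : V -> term W) (g : W -> term X) :
  (fun v => tsubst (up g) (up f v)) =1 up (fun v => tsubst g (f v)).
Proof. by case=> [v|] //=; rewrite shift_tsubst. Qed.

Lemma nsubst_comp (V W X : Set) (f : V -> term W) (g : W -> term X) A :
  nsubst g (nsubst f A) = nsubst (fun v => tsubst g (f v)) A.
Proof.
elim/nf_set_ind: A W X f g => {V} [V b P|V A IHA B IHB|V A IHA B IHB|V A IH|V A IH] W X f g /=.
- by rewrite asubst_comp.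
- by rewrite IHA IHB.
- by rewrite IHA IHB.
- by rewrite IH; congr Univ; apply: nsubst_ext; apply: up_comp.
- by rewrite IH; congr Exis; apply: nsubst_ext; apply: up_comp.
Qed.

Lemma inst_nsubst (V : Set) (f : V -> closed) A c :
  inst (nsubst (up f) A) c = nsubst (oapp f c) A.
Proof.
rewrite /inst nsubst_comp; apply: nsubst_ext => -[v|] //=.
by rewrite tsubst_shift; apply: tsubst_Var.
Qed.

Lemma nsubst_Var (V : Set) (A : nf V) : nsubst Var A = A.
Proof.
have upV W : up (@Var W) =1 Var by case.
elim/nf_set_ind: A => {V} [V b P|V A IHA B IHB|V A IHA B IHB|V A IH|V A IH] /=;
  rewrite ?asubst_Var ?IHA ?IHB // (nsubst_ext _ (@upV _)) IH //.
Qed.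

Lemma nnf_fsubst (V W : Set) (f : V -> term W) p A :
  nnf p (fsubst f A) = nsubst f (nnf p A).
Proof.
elim/formula_set_ind: A p W f => {V} [V P|V A IH|V A IHA B IHB|V A IHA B IHB|V A IH] [] W f //=;
  by rewrite ?IH ?IHA ?IHB.
Qed.

(** Inverting [nconv], a family indexed by the scope, would produce equations between dependent
    pairs; this recursive form reduces by computation. *)
Fixpoint nconvb (V : Type) (A : nf V) : nf V -> Prop :=
  match A with
  | Lit b P => fun B => if B is Lit b' Q then b = b' /\ aconv P Q else False
  | Conj A A' => fun B => if B is Conj B B' then nconvb A B /\ nconvb A' B' else False
  | Disj A A' => fun B => if B is Disj B B' then nconvb A B /\ nconvb A' B' else False
  | Univ A => fun B => if B is Univ B then nconvb A B else False
  | Exis A => fun B => if B is Exis B then nconvb A B else False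
  end.

Lemma nconvP (V : Type) (A B : nf V) : nconv A B <-> nconvb A B.
Proof.
split; first by elim=> //=.
elim: A B => {V} [V b P|V A IHA A' IHA'|V A IHA A' IHA'|V A IH|V A IH] [] //=;
  try by move=> *; constructor; auto.
- by move=> b' Q [<-]; constructor.
- by move=> B B' []; constructor; auto.
- by move=> B B' []; constructor; auto.
Qed.

Lemma aconv_refl ext V (P : atom ext V) : aconv P P.
Proof. by case: P => *; constructor. Qed.

Lemma aconv_sym ext V (P Q : atom ext V) : aconv P Q -> aconv Q P.
Proof. by case=> *; constructor; apply: conv_sym. Qed.

Lemma aconv_trans ext V (P Q R : atom ext V) :
  aconv P Q -> aconv Q R -> aconv P R.
Proof.
by case=> * ; match goal with H : aconv _ _ |- _ => inversion H end; subst;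
  constructor; (apply: conv_trans; eassumption).
Qed.

Lemma aconv_asubst ext V W (f : V -> term W) (P Q : atom ext V) :
  aconv P Q -> aconv (asubst f P) (asubst f Q).
Proof. by case=> *; constructor; apply: conv_tsubst. Qed.

#[local] Hint Resolve aconv_refl : core.

Lemma nconv_refl (V : Type) (A : nf V) : nconv A A.
Proof. by elim: A => *; constructor. Qed.
#[local] Hint Resolve nconv_refl : core.

Lemma nconv_sym (V : Type) (A B : nf V) : nconv A B -> nconv B A.
Proof. by elim=> *; constructor => //; apply: aconv_sym. Qed.

Lemma nconv_trans (V : Type) (A B C : nf V) : nconv A B -> nconv B C -> nconv A C.
Proof.
move=> AB; elim: AB C => {V A B}
    [V b P Q PQ|V A A' B B' _ IHA _ IHB|V A A' B B' _ IHA _ IHB|V A A' _ IH|V A A' _ IH]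
    C /nconvP; case: C => //=.
- by move=> b' R [<- QR]; constructor; apply: aconv_trans PQ QR.
- by move=> C C' [/nconvP H /nconvP H']; constructor; auto.
- by move=> C C' [/nconvP H /nconvP H']; constructor; auto.
- by move=> C /nconvP H; constructor; auto.
- by move=> C /nconvP H; constructor; auto.
Qed.

Lemma conv_pair V (s t s' t' : term V) :
  conv (pair s t) (pair s' t') -> conv s s' /\ conv t t'.
Proof. by case/conv_inert2. Qed.

Ltac clash H :=
  solve [ by case: (conv_inert12 H erefl erefl)
        | by case: (conv_inert12 (conv_sym H) erefl erefl)
        | by case: (conv_inert1 H erefl erefl) ].

(* Every formula is coded by a term with an inert head, and l is the only
   such head that takes two arguments. *)
Lemma dot_inj (V : Set) (A B : formula true V) a b p :
  dot A = Some a -> dot B = Some b -> conv a b -> nconv (nnf p A) (nnf p B).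
Proof.
elim/formula_set_ind: A B a b p => {V} [V P|V A IH|V A IHA A' IHA'|V A IHA A' IHA'|V A IH] B a b p.
- case: P => [s t|t|t|t|e s t] //= [<-]; case: B => [[s' t'|t'|t'|t'|e' s' t']|B|B B'|B B'|B] //=;
    try by [case=> <- H; clash H
           |case: dot => //= b' [<-] H; clash H
           |case: dot => //= b'; case: dot => //= b'' [<-] H; clash H].
  + case=> <- /conv_inert1 /(_ erefl erefl) [_ /conv_pair []].
    by do 2!constructor.
  + by case=> <- /conv_inert1 /(_ erefl erefl) [_ ?]; do 2!constructor.
  + by case=> <- /conv_inert1 /(_ erefl erefl) [_ ?]; do 2!constructor.
  + by case=> <- /conv_inert2 /(_ erefl erefl) [_ ? ?]; do 2!constructor.
- rewrite /=; case E: dot => [a'|] //= [<-]; case: B => [[s' t'|t'|t'|t'|e' s' t']|B|B B'|B B'|B] //=;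
    try by [case=> <- H; clash H
           |case: dot => //= b' [<-] H; clash H
           |case: dot => //= b'; case: dot => //= b'' [<-] H; clash H].
  case E': dot => [b'|] //= [<-] /conv_inert1 /(_ erefl erefl) [_ H].
  exact: IH E E' H.
- rewrite /=; case E: dot => [a'|] //=; case Ea: dot => [a''|] //= [<-].
  case: B => [[s' t'|t'|t'|t'|e' s' t']|B|B B'|B B'|B] //=;
    try by [case=> <- H; clash H
           |case: dot => //= b' [<-] H; clash H
           |case: dot => //= b'; case: dot => //= b'' [<-] H; clash H].
  case E': dot => [b'|] //=; case Eb: dot => [b''|] //= [<-].
  move=> /conv_inert1 /(_ erefl erefl) [_ /conv_pair [H H']].
  by case: p; constructor; eauto.
- rewrite /=; case E: dot => [a'|] //=; case Ea: dot => [a''|] //= [<-].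
  case: B => [[s' t'|t'|t'|t'|e' s' t']|B|B B'|B B'|B] //=;
    try by [case=> <- H; clash H
           |case: dot => //= b' [<-] H; clash H
           |case: dot => //= b'; case: dot => //= b'' [<-] H; clash H].
  case E': dot => [b'|] //=; case Eb: dot => [b''|] //= [<-].
  move=> /conv_inert1 /(_ erefl erefl) [_ /conv_pair [H H']].
  by case: p; constructor; eauto.
- rewrite /=; case E: dot => [a'|] //= [<-]; case: B => [[s' t'|t'|t'|t'|e' s' t']|B|B B'|B B'|B] //=;
    try by [case=> <- H; clash H
           |case: dot => //= b' [<-] H; clash H
           |case: dot => //= b'; case: dot => //= b'' [<-] H; clash H].
  case E': dot => [b'|] //= [<-] /conv_inert1 /(_ erefl erefl) [_ /conv_lam H].
  by case: p; constructor; eauto.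
Qed.

(** Both signs matter, since the rules for [T] and its negation have premises [nnf true A] and
    [nnf false A]: in either case the term fixes the premise up to convertibility. *)
Lemma codes_inj t A B p : codes t A -> codes t B -> nconv (nnf p A) (nnf p B).
Proof.
move=> [a Ea ta] [b Eb tb]; apply: dot_inj Ea Eb _.
exact: conv_trans (conv_sym ta) tb.
Qed.

Lemma codes_conv s t A : conv s t -> codes s A -> codes t A.
Proof. by move=> st [a Ea sa]; exists a => //; apply: conv_trans (conv_sym st) sa. Qed.

Lemma codes_neg t A : codes (Cst Cneg ∙ t) A ->
  exists2 B, codes t B & forall p, nnf p A = nnf (~~ p) B.
Proof.
move=> [a]; case: A => [[s' t'|t'|t'|t'|e' s' t']|B|B B'|B B'|B] //=;
    try by [case=> <- H; clash H
           |case: dot => //= b' [<-] H; clash H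
           |case: dot => //= b'; case: dot => //= b'' [<-] H; clash H].
case E: dot => [b|] //= [<-] /conv_inert1 /(_ erefl erefl) [_ H].
by exists B => //; exists b.
Qed.

Lemma codes_Neg t B : codes t B -> codes (Cst Cneg ∙ t) (Neg B).
Proof.
by move=> [b E H]; exists (Cst Cneg ∙ b); [rewrite /= E|apply: conv_app].
Qed.

(** * Ordinals *)

Lemma ole_refl a : ole a a.
Proof. by elim: a => I f IH /= i; exists i. Qed.
#[local] Hint Resolve ole_refl : core.

Lemma olt_ole_trans a b c : olt a b -> ole b c -> olt a c.
Proof.
case: b c => [J g] [K h] /= [j aj] /(_ j) [k jk].
by exists k; apply: ole_trans aj jk.
Qed.

Lemma ole_olt_trans a b c : ole a b -> olt b c -> olt a c.
Proof. by case: c => K h ab [k bk]; exists k; apply: ole_trans ab bk. Qed.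

Lemma olt_osup I (f : I -> ord) i : olt (f i) (osup f).
Proof. by exists i. Qed.

Lemma oleP I (f : I -> ord) b : ole (osup f) b <-> forall i, olt (f i) b.
Proof. by case: b. Qed.

Lemma oltW a b : olt a b -> ole a b.
Proof.
elim: a b => I f IH b ab; apply/oleP => i.
case: b ab => J g [j aj]; exists j; apply: IH.
exact: olt_ole_trans (olt_osup f i) aj.
Qed.

Lemma olt_trans a b c : olt a b -> olt b c -> olt a c.
Proof. by move=> ab /oltW; apply: olt_ole_trans. Qed.

(** The dichotomies need a joint induction: the first for [osup f] calls on the second for the
    branches [f i], and the second follows by comparing [osup f] with the branches of [b] through
    the first. *)
Lemma ole_total_aux a :
  (forall b, ole a b \/ olt b a) /\ (forall b, olt a b \/ ole b a).
Proof.
elim: a => I f IH.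
have le_lt b : ole (osup f) b \/ olt b (osup f).
  case: (classic (forall i, olt (f i) b)) => [/oleP|/not_all_ex_not [i nlt]]; first by left.
  by right; exists i; have [_ /(_ b) []] := IH i.
split=> // -[J g].
case: (classic (exists j, ole (osup f) (g j))) => [|nle]; first by left.
right; apply/oleP => j; case: (le_lt (g j)) => // le_j.
by case: nle; exists j.
Qed.

Lemma ole_total a b : ole a b \/ olt b a.
Proof. by case: (ole_total_aux a). Qed.

Lemma omax a b : exists c, [/\ ole a c, ole b c & c = a \/ c = b].
Proof.
case: (ole_total a b) => [ab|/oltW ba]; [exists b|exists a]; split; auto.
Qed.

Lemma osuccP a b : olt a (osucc b) <-> ole a b.
Proof. by split=> [[]|] //; exists tt. Qed.

Lemma olt_min (P : ord -> Prop) a : P a ->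
  exists2 b, P b & forall c, olt c b -> ~ P c.
Proof.
elim/(well_founded_ind olt_wf): a => a IH Pa.
case: (classic (exists2 c, olt c a & P c)) => [[c ca Pc]|no]; first exact: IH ca Pc.
by exists a => // c ca Pc; apply: no; exists c.
Qed.

(** * Derivability at a fixed stage *)

(** The height gamma is quantified away, while beta is kept: consistency goes by induction on the
    stage and on beta. *)
Definition deriv_rank (alpha beta : ord) (G : sequent) : Prop :=
  exists gamma, derives alpha beta gamma G.
Definition deriv (alpha : ord) (G : sequent) : Prop :=
  exists beta, deriv_rank alpha beta G.
Definition deriv_lt (alpha : ord) (G : sequent) : Prop :=
  exists alpha0, exists _ : olt alpha0 alpha, deriv alpha0 G.

(** The recursive call occurs only inside a proposition, so functional and propositional
    extensionality supply the congruence condition of [Fix_eq]. *)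
Lemma derivesE alpha :
  derives alpha = stage (deriv_lt alpha) (is_succ alpha).
Proof.
rewrite /derives Fix_eq // => x f g fg; congr stage.
apply: functional_extensionality => G; apply: propositional_extensionality.
by split=> -[a [lt_a [b [c H]]]]; exists a, lt_a, b, c; move: H; rewrite fg.
Qed.

Definition subq (G G' : sequent) : Prop := forall A, mem A G -> mem A G'.

Lemma mem_cons A B G : mem A (B :: G) <-> nconv A B \/ mem A G.
Proof.
split=> [[C [<-|CG] AeqC]|[AB|[C CG AeqC]]]; first by left.
- by right; exists C.
- by exists B; [left|].
- by exists C; [right|].
Qed.

Lemma mem_head A G : mem A (A :: G).
Proof. by apply/mem_cons; left. Qed.
#[local] Hint Resolve mem_head : core.

Lemma mem1 A B : mem A [:: B] -> nconv A B.
Proof. by move/mem_cons => [//|[]]. Qed.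

Lemma mem_In A G : List.In A G -> mem A G.
Proof. by move=> AG; exists A. Qed.

Lemma subq_cons A G G' : subq G G' -> subq (A :: G) (A :: G').
Proof.
move=> GG' B /mem_cons [AB|BG]; apply/mem_cons; first by left.
by right; apply: GG'.
Qed.
#[local] Hint Resolve subq_cons : core.

Lemma subq1 A B : nconv A B -> subq [:: A] [:: B].
Proof. by move=> AB C /mem1 CA; apply/mem_cons; left; apply: nconv_trans CA AB. Qed.

(** The rules read their context only through [mem], so weakening comes together with contraction
    and the exchange of convertible sentences. The rules for [T] discard the context, and their
    premises are reused unchanged. *)
Lemma stage_sub prev succ beta gamma G G' :
  (forall G G', subq G G' -> prev G -> prev G') ->
  stage prev succ beta gamma G -> subq G G' -> stage prev succ beta gamma G'.
Proof.
move=> prevS H; elim: H G' => {beta gamma G}.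
- by move=> b c G p P HP /[swap] G' /[swap] S /S; apply: R_Lit.
- by move=> b c G a H1 H2 G' S; apply: R_Log (S _ H1) (S _ H2).
- move=> b c c0 c1 G A0 A1 H lt0 _ IH0 lt1 _ IH1 G' S.
  by apply: R_Conj (S _ H) lt0 _ lt1 _; auto.
- move=> b c c0 G A0 A1 H lt0 _ IH0 G' S.
  by apply: R_Disj0 (S _ H) lt0 _; auto.
- move=> b c c0 G A0 A1 H lt0 _ IH0 G' S.
  by apply: R_Disj1 (S _ H) lt0 _; auto.
- move=> b c c0 G A a H lt0 _ IH0 G' S.
  by apply: R_Exis (S _ H) lt0 _; auto.
- move=> b c c0 G A H lt0 _ IH0 G' S.
  by apply: R_Univ (S _ H) lt0 _; auto.
- move=> b c b0 c0 G t A H ct ltb ltc HA _ G' S.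
  exact: R_T (S _ H) ct ltb ltc HA.
- move=> b c b0 c0 G t A H ct ltb ltc HA _ G' S.
  exact: R_negT (S _ H) ct ltb ltc HA.
- by move=> b c G H G' S; apply: R_Weak; apply: prevS S H.
- move=> b c G a d H1 H2 H3 H4 H5 H6 G' S.
  exact: R_U H1 H2 H3 H4 H5 (S _ H6).
- move=> b c G a d H1 H2 H3 H4 H5 H6 G' S.
  exact: R_negU H1 H2 H3 H4 H5 (S _ H6).
Qed.

Lemma deriv_rank_sub alpha beta G G' :
  subq G G' -> deriv_rank alpha beta G -> deriv_rank alpha beta G'.
Proof.
elim/(well_founded_ind olt_wf): alpha beta G G' => alpha IH beta G G' S [gamma].
rewrite derivesE => H; exists gamma; rewrite derivesE.
apply: stage_sub H S => {}G {}G' S [a0 [lt0 [b Hb]]].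
by exists a0, lt0, b; apply: IH Hb.
Qed.

Lemma deriv_sub alpha G G' : subq G G' -> deriv alpha G -> deriv alpha G'.
Proof. by move=> S [b H]; exists b; apply: deriv_rank_sub H. Qed.

Lemma deriv_lt_sub alpha G G' :
  subq G G' -> deriv_lt alpha G -> deriv_lt alpha G'.
Proof. by move=> S [a [lt_a H]]; exists a, lt_a; apply: deriv_sub H. Qed.

Lemma deriv_rank_mono alpha beta beta' G :
  ole beta beta' -> deriv_rank alpha beta G -> deriv_rank alpha beta' G.
Proof.
move=> le_b [gamma H]; exists gamma; move: H; rewrite derivesE => H.
elim: H beta' le_b => {beta gamma G}; eauto using stage, olt_ole_trans.
Qed.

Lemma deriv_rank_weak alpha beta G : deriv_lt alpha G -> deriv_rank alpha beta G.
Proof. by exists beta; rewrite derivesE; apply: R_Weak. Qed.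

Lemma deriv_lt_mono alpha alpha' G :
  ole alpha alpha' -> deriv_lt alpha G -> deriv_lt alpha' G.
Proof.
by move=> le_a [a [lt_a H]]; exists a; exists (olt_ole_trans lt_a le_a).
Qed.

Lemma deriv_rank_stage_mono alpha alpha' beta G :
  ole alpha alpha' -> deriv_rank alpha beta G -> deriv_rank alpha' beta G.
Proof.
(* Different trees may denote the same ordinal; the two stages then have equal parameters. A
   strictly larger stage is reached by the rule Weak, which allows any rank. *)
move=> le_a; case: (ole_total alpha' alpha) => [le_a'|lt_a].
  have E1 : deriv_lt alpha = deriv_lt alpha'.
    apply: functional_extensionality => X; apply: propositional_extensionality.
    by split; apply: deriv_lt_mono.
  have E2 : is_succ alpha = is_succ alpha'.
    apply: propositional_extensionality.
    by split=> -[c [? ?]]; exists c; split; apply: ole_trans; eassumption.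
  by rewrite /deriv_rank !derivesE E1 E2.
by move=> H; apply: deriv_rank_weak; exists alpha, lt_a, beta.
Qed.

Lemma deriv_mono alpha alpha' G :
  ole alpha alpha' -> deriv alpha G -> deriv alpha' G.
Proof. by move=> le_a [b H]; exists b; apply: deriv_rank_stage_mono H. Qed.

Lemma deriv_lt_deriv alpha G : deriv_lt alpha G -> deriv alpha G.
Proof. by exists (osucc alpha); apply: deriv_rank_weak. Qed.

Lemma deriv_ltE alpha G : deriv_lt (osucc alpha) G <-> deriv alpha G.
Proof.
split=> [[a [/osuccP le_a H]]|H]; first exact: deriv_mono H.
by exists alpha; exists (proj2 (osuccP _ _) (ole_refl alpha)).
Qed.

Lemma deriv_lt_olt alpha alpha' G :
  olt alpha alpha' -> deriv alpha G -> deriv_lt alpha' G.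
Proof. by move=> lt_a H; exists alpha, lt_a. Qed.

Section Rules.
Variable alpha : ord.
Local Notation D := (deriv_rank alpha).

Lemma rank_Lit beta G p P : CTT_true p P -> mem (Lit p P) G -> D beta G.
Proof. by exists beta; rewrite derivesE; apply: R_Lit; eassumption. Qed.

Lemma rank_Log beta G a :
  mem (pos_lit (AT a)) G -> mem (neg_lit (AT a)) G -> D beta G.
Proof. by exists beta; rewrite derivesE; apply: R_Log; eassumption. Qed.

Lemma rank_Conj beta G A B :
  mem (Conj A B) G -> D beta (A :: G) -> D beta (B :: G) -> D beta G.
Proof.
rewrite /deriv_rank derivesE => AB [g0 H0] [g1 H1].
exists (osup (fun b : bool => if b then g0 else g1)).
by apply: R_Conj AB _ H0 _ H1; [exists true|exists false].
Qed.

Lemma rank_Disj0 beta G A B : mem (Disj A B) G -> D beta (A :: G) -> D beta G.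
Proof.
rewrite /deriv_rank derivesE => AB [g0 H0]; exists (osucc g0).
by apply: R_Disj0 AB _ H0; apply/osuccP.
Qed.

Lemma rank_Disj1 beta G A B : mem (Disj A B) G -> D beta (B :: G) -> D beta G.
Proof.
rewrite /deriv_rank derivesE => AB [g0 H0]; exists (osucc g0).
by apply: R_Disj1 AB _ H0; apply/osuccP.
Qed.

Lemma rank_Exis beta G A a :
  mem (Exis A) G -> D beta (inst A a :: G) -> D beta G.
Proof.
rewrite /deriv_rank derivesE => AB [g0 H0]; exists (osucc g0).
by apply: R_Exis AB _ H0; apply/osuccP.
Qed.

Lemma rank_Univ beta G A :
  mem (Univ A) G -> (forall a, D beta (inst A a :: G)) -> D beta G.
Proof.
rewrite /deriv_rank derivesE => AB /choice [g0 H0]; exists (osup g0).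
by apply: R_Univ AB _ H0 => a; apply: olt_osup.
Qed.

Lemma rank_T beta beta0 p G t A : mem (Lit p (AT t)) G -> codes t A ->
  olt beta0 beta -> D beta0 [:: nnf p A] -> D beta G.
Proof.
rewrite /deriv_rank derivesE => AB ct ltb [g0 H0]; exists (osucc g0).
by case: p AB H0 => AB H0; [apply: R_T AB ct ltb _ H0|apply: R_negT AB ct ltb _ H0];
  apply/osuccP.
Qed.

(* The side conditions and the premise under which the rules U and not-U yield
   the literal [Lit p (Lat a b)] at stage [alpha]. *)
Definition decides (p : bool) (a b : closed) : Prop :=
  [/\ is_succ alpha, decided (deriv_lt alpha) a,
      forall q, ~ deriv_lt alpha [:: Lit q (Lat a b)]
    & if p then on_term (deriv_lt alpha) b else ~ on_term (deriv_lt alpha) b].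

Lemma rank_U beta p a b G :
  decides p a b -> mem (Lit p (Lat a b)) G -> D beta G.
Proof.
move=> [succ dec no H] abG; exists beta; rewrite derivesE.
have [not1 not2] := (no true, no false).
by case: p abG H => abG H; [apply: R_U abG|apply: R_negU abG].
Qed.

End Rules.

Lemma deriv_T alpha p t A :
  codes t A -> deriv alpha [:: nnf p A] -> deriv alpha [:: Lit p (AT t)].
Proof.
move=> ct [b H]; exists (osucc b); apply: rank_T ct _ H; last exact/osuccP.
exact: mem_head.
Qed.

(** The rules of cut-free omega-logic. The completeness argument sees the rules for [T] and [L] only
    through the literals that [D] derives. *)
Record omega_closed (D : sequent -> Prop) : Prop := OmegaClosed {
  oc_sub G G' : subq G G' -> D G -> D G';
  oc_Lit G p P : CTT_true p P -> mem (Lit p P) G -> D G;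
  oc_Log G a : mem (pos_lit (AT a)) G -> mem (neg_lit (AT a)) G -> D G;
  oc_Conj G A B : mem (Conj A B) G -> D (A :: G) -> D (B :: G) -> D G;
  oc_Disj0 G A B : mem (Disj A B) G -> D (A :: G) -> D G;
  oc_Disj1 G A B : mem (Disj A B) G -> D (B :: G) -> D G;
  oc_Exis G A a : mem (Exis A) G -> D (inst A a :: G) -> D G;
  oc_Univ G A : mem (Univ A) G -> (forall a, D (inst A a :: G)) -> D G
}.

(** Premises may come with different ranks. They are raised to a common one: the larger of two or,
    in the omega-rule, a bound for a chosen family of ranks. *)
Lemma deriv_omega_closed alpha : omega_closed (deriv alpha).
Proof.
split.
- exact: deriv_sub.
- by move=> G p P HP PG; exists (osucc alpha); apply: rank_Lit PG.
- by move=> G a H1 H2; exists (osucc alpha); apply: rank_Log H1 H2.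
- move=> G A B AB [b0 H0] [b1 H1]; have [b [le0 le1 _]] := omax b0 b1.
  by exists b; apply: rank_Conj AB _ _;
    [apply: deriv_rank_mono H0|apply: deriv_rank_mono H1].
- by move=> G A B AB [b H]; exists b; apply: rank_Disj0 AB H.
- by move=> G A B AB [b H]; exists b; apply: rank_Disj1 AB H.
- by move=> G A a AG [b H]; exists b; apply: rank_Exis AG H.
- move=> G A AG /choice [f H]; exists (osup f); apply: rank_Univ AG _ => a.
  by apply: deriv_rank_mono (H a); apply/oltW/olt_osup.
Qed.

Lemma on_term_sub (D D' : sequent -> Prop) t :
  (forall G, D G -> D' G) -> on_term D t -> on_term D' t.
Proof. by move=> DD' [A ct /DD']; exists A. Qed.

Lemma on_term_conv (D : sequent -> Prop) s t : conv s t -> on_term D s -> on_term D t.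
Proof. by move=> st [A cs DA]; exists A => //; apply: codes_conv st cs. Qed.

Lemma decided_conv (D : sequent -> Prop) a a' : conv a a' -> decided D a -> decided D a'.
Proof.
by move=> aa' dec c; case: (dec c) => H; [left|right]; apply: on_term_conv H;
  do ?apply: conv_app.
Qed.

Lemma nconv_Lat p a a' b b' :
  conv a a' -> conv b b' -> nconv (Lit p (Lat a b)) (Lit p (Lat a' b')).
Proof. by do 2!constructor. Qed.

Lemma decides_conv alpha p a a' b b' :
  conv a a' -> conv b b' -> decides alpha p a b -> decides alpha p a' b'.
Proof.
move=> aa' bb' [succ dec no H]; split=> //.
- exact: decided_conv dec.
- move=> q; have := no q; apply: contra_not; apply: deriv_lt_sub.
  by apply/subq1/nconv_Lat; apply: conv_sym.
- case: p H; first exact: on_term_conv.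
  by apply: contra_not; apply: on_term_conv; apply: conv_sym.
Qed.

Lemma decides_deriv alpha p a b :
  decides alpha p a b -> deriv alpha [:: Lit p (Lat a b)].
Proof. by move=> H; exists alpha; apply: rank_U H _. Qed.

(** If [alpha'] were smaller, the literal introduced there would already be derivable before
    [alpha], which the side condition at [alpha] forbids. *)
Lemma decides_ole alpha alpha' p p' a b :
  decides alpha p a b -> decides alpha' p' a b -> ole alpha alpha'.
Proof.
move=> [_ _ no _] /decides_deriv H; case: (ole_total alpha alpha') => // lt_a.
by case: (no p'); apply: deriv_lt_olt H.
Qed.

(** The positive decision is not later than the negative one, so [b] is derivable before [alpha']
    too, against the premise of the negative rule. *)
Lemma decides_consistent alpha alpha' a b :
  decides alpha true a b -> decides alpha' false a b -> False.
Proof.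
move=> H1 H2; have le_a := decides_ole H1 H2.
case: H2 => _ _ _; apply; case: H1 => _ _ _.
by apply: on_term_sub => G; apply: deriv_lt_mono.
Qed.

(** The two alternatives for [AT] are the two ways of descending in the pair of stage and rank. For
    [AL] the deciding stage may lie below [alpha], because Weak can have carried the literal
    upwards. *)
Definition lit_cause (alpha beta : ord) (p : bool) (P : atom true void) : Prop :=
  match P with
  | AT t => exists2 A, codes t A & deriv_lt alpha [:: nnf p A] \/
              exists2 beta0, olt beta0 beta & deriv_rank alpha beta0 [:: nnf p A]
  | AU _ => False
  | AL _ a b => exists2 alpha', ole alpha' alpha & decides alpha' p a b
  | _ => CTT_true p P
  end.

Lemma CTT_true_aconv p P Q : aconv P Q -> CTT_true p P -> CTT_true p Q.
Proof.
case=> //= [s s' t t' ss' tt'|t t' tt']; case: p.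
- by move=> st; apply: conv_trans (conv_sym ss') (conv_trans st tt').
- apply: contra_not => st'.
  exact: conv_trans ss' (conv_trans st' (conv_sym tt')).
- exact: is_nat_conv.
- by apply: contra_not; apply: is_nat_conv; apply: conv_sym.
Qed.

(** Principal formulas persist in the sequent, so a sequent with a single literal excludes all
    logical rules; Log is excluded as it needs both signs. *)
Lemma lit_inv alpha beta p P :
  deriv_rank alpha beta [:: Lit p P] -> lit_cause alpha beta p P.
Proof.
elim/(well_founded_ind olt_wf): alpha beta => alpha IH beta [gamma].
rewrite derivesE => H.
have memLit q Q : mem (Lit q Q) [:: Lit p P] -> q = p /\ aconv Q P.
  by move/mem1/nconvP.
have noLit A : mem A [:: Lit p P] -> if A is Lit _ _ then True else False.
  by move/mem1/nconvP; case: A.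
have T_cause q t A b0 : mem (Lit q (AT t)) [:: Lit p P] -> codes t A ->
    olt b0 beta -> deriv_rank alpha b0 [:: nnf q A] -> lit_cause alpha beta p P.
  move=> /memLit [-> tP] ct lt_b HA; inversion tP; subst.
  exists A; first exact: codes_conv ct.
  by right; exists b0.
have U_cause q a b : mem (Lit q (Lat a b)) [:: Lit p P] -> decides alpha q a b ->
    lit_cause alpha beta p P.
  move=> /memLit [-> abP] dec; inversion abP; subst.
  by exists alpha => //; apply: decides_conv dec.
inversion H; subst;
  try by match goal with G0 : mem _ _ |- _ => move/noLit: G0 end.
- have [<- QP] := memLit _ _ H1.
  by have := CTT_true_aconv QP H0; case: (P) => // ? [].
- by have [E1 _] := memLit _ _ H0; have [] := memLit _ _ H1; rewrite -E1.
- by apply: T_cause H0 H1 H2 _; eexists; rewrite derivesE; eassumption.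
- by apply: T_cause H0 H1 H2 _; eexists; rewrite derivesE; eassumption.
(* Weak: the cause found at the earlier stage [a] is also one for [alpha]; a premise of smaller rank
   at stage [a] becomes a premise from an earlier stage. *)
- move: H0 => [a [lt_a [b /(IH _ lt_a)]]]; case: (P) => //=.
    move=> t [A ct HA]; exists A => //; left.
    case: HA => [[a' [lt_a' HA]]|[b0 _ HA]].
      by exists a', (olt_trans lt_a' lt_a).
    by exists a, lt_a, b0.
  by move=> e s t [a' le_a' dec]; exists a' => //; apply: ole_trans le_a' (oltW lt_a).
- by apply: U_cause H5 _; split=> // -[].
- by apply: U_cause H5 _; split=> // -[].
Qed.

Lemma lit_inv_T alpha p t : deriv alpha [:: Lit p (AT t)] ->
  exists2 A, codes t A & deriv alpha [:: nnf p A].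
Proof.
move=> [b /lit_inv [A ct H]]; exists A => //.
by case: H => [/deriv_lt_deriv//|[b0 _ H]]; exists b0.
Qed.

Lemma on_term_codes alpha t A :
  codes t A -> on_term (deriv alpha) t <-> deriv alpha [:: nnf true A].
Proof.
move=> ct; split=> [[B cB]|]; last by exists A.
by apply/deriv_sub/subq1; apply: codes_inj cB ct.
Qed.

(** * Supervaluations *)

Definition is_T V (P : atom true V) : bool := if P is AT _ then true else false.

(* A valuation assigns truth and falsity to literals; only [AT] is required to
   be two-valued, since the calculus has no axiom [L_a(b), ~ L_a(b)]. *)
Record valuation (lt : bool -> atom true void -> Prop) : Prop := Valuation {
  val_aconv p P Q : aconv P Q -> lt p P -> lt p Q;
  val_T t : lt false (AT t) <-> ~ lt true (AT t)
}.

Section Truth.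
Variable lt : bool -> atom true void -> Prop.

Fixpoint holds (V : Type) (rho : V -> closed) (A : nf V) : Prop :=
  match A with
  | Lit p P => lt p (asubst rho P)
  | Conj A B => holds rho A /\ holds rho B
  | Disj A B => holds rho A \/ holds rho B
  | Univ A => forall c, holds (oapp rho c) A
  | Exis A => exists c, holds (oapp rho c) A
  end.

Definition holds_seq (G : sequent) : Prop := exists2 A, mem A G & holds Var A.

Lemma holds_nsubst (V W : Set) (f : V -> term W) (rho : W -> closed) A :
  holds rho (nsubst f A) <-> holds (fun v => tsubst rho (f v)) A.
Proof.
elim/nf_set_ind: A W f rho => {V} [V p P|V A IHA B IHB|V A IHA B IHB|V A IH|V A IH] W f rho /=.
- by rewrite asubst_comp.
- by rewrite IHA IHB.
- by rewrite IHA IHB.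
- have E c : (fun v => tsubst (oapp rho c) (up f v)) = oapp (fun v => tsubst rho (f v)) c.
    by apply: functional_extensionality => -[v|] //=; rewrite tsubst_shift.
  by split=> H c; have := H c; rewrite IH E.
- have E c : (fun v => tsubst (oapp rho c) (up f v)) = oapp (fun v => tsubst rho (f v)) c.
    by apply: functional_extensionality => -[v|] //=; rewrite tsubst_shift.
  by split=> -[c H]; exists c; move: H; rewrite IH E.
Qed.

Lemma holds_inst A c : holds Var (inst A c) <-> holds (oapp Var c) A.
Proof.
rewrite /inst holds_nsubst.
have -> // : (fun v => tsubst Var (oapp (@Var void) c v)) = oapp Var c.
by apply: functional_extensionality => v; apply: tsubst_Var.
Qed.

Hypothesis lt_val : valuation lt.

Lemma holds_nconv (V : Type) (rho : V -> closed) A B :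
  nconv A B -> holds rho A -> holds rho B.
Proof.
move=> AB; elim: AB rho => {V A B}
    [V b P Q PQ|V A A' B B' _ IHA _ IHB|V A A' B B' _ IHA _ IHB|V A A' _ IH|V A A' _ IH] rho /=.
- by apply: val_aconv => //; apply: aconv_asubst.
- by case=> /IHA ? /IHB.
- by case=> [/IHA|/IHB]; auto.
- by move=> H c; apply: IH.
- by case=> c H; exists c; apply: IH.
Qed.

Lemma holds_seq_cons A G : holds_seq (A :: G) -> holds Var A \/ holds_seq G.
Proof.
move=> [B /mem_cons [/nconv_sym AB|BG] HB]; last by right; exists B.
by left; apply: holds_nconv HB; apply: nconv_sym.
Qed.

Lemma holds_seq1 A : holds_seq [:: A] -> holds Var A.
Proof. by case/holds_seq_cons => // -[B []]. Qed.

(** The rules for [T] and [L] conclude with a literal derivable at this very stage and rank, true by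
    assumption, so their premises need no interpretation. Log holds because [T] is two-valued. *)
Lemma sound alpha beta G :
  (forall p P, deriv_rank alpha beta [:: Lit p P] -> lt p P) ->
  deriv_rank alpha beta G -> holds_seq G.
Proof.
elim/(well_founded_ind olt_wf): alpha beta G => alpha IH beta G ax [gamma].
rewrite derivesE => H; elim: H ax => {beta gamma G}.
- move=> b c G p P HP PG ax; exists (Lit p P) => //=; rewrite asubst_Var.
  by apply: ax; apply: rank_Lit HP _.
- move=> b c G a H1 H2 _; case: (classic (lt true (AT a))) => H.
    by exists (pos_lit (AT a)) => //=; rewrite tsubst_Var.
  by exists (neg_lit (AT a)) => //=; rewrite tsubst_Var; apply/val_T.
- move=> b c c0 c1 G A0 A1 H _ _ IH0 _ _ IH1 ax.
  case/holds_seq_cons: (IH0 ax) => // h0; case/holds_seq_cons: (IH1 ax) => // h1.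
  by exists (Conj A0 A1).
- move=> b c c0 G A0 A1 H _ _ IH0 ax; case/holds_seq_cons: (IH0 ax) => // h0.
  by exists (Disj A0 A1) => //; left.
- move=> b c c0 G A0 A1 H _ _ IH0 ax; case/holds_seq_cons: (IH0 ax) => // h0.
  by exists (Disj A0 A1) => //; right.
- move=> b c c0 G A a H _ _ IH0 ax.
  case/holds_seq_cons: (IH0 ax) => // /holds_inst h0.
  by exists (Exis A) => //; exists a.
(* If no sentence of [G] held, every premise would make its instance true, and then the universal
   sentence would hold. *)
- move=> b c c0 G A H _ _ IH0 ax; apply: NNPP => no.
  apply: (no); exists (Univ A) => // a; apply/holds_inst.
  by case/holds_seq_cons: (IH0 a ax).
- move=> b c b0 c0 G t A H ct lt_b lt_c HA _ ax.
  exists (pos_lit (AT t)) => //=; rewrite tsubst_Var; apply: ax.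
  by apply: rank_T ct lt_b _; [|exists c0; rewrite derivesE].
- move=> b c b0 c0 G t A H ct lt_b lt_c HA _ ax.
  exists (neg_lit (AT t)) => //=; rewrite tsubst_Var; apply: ax.
  by apply: rank_T ct lt_b _; [|exists c0; rewrite derivesE].
- move=> b c G [a [lt_a [b' H]]] ax; apply: (IH _ lt_a _ _ _ H) => p P HP.
  by apply/ax/deriv_rank_weak; exists a, lt_a, b'.
- move=> b c G a d su dec not1 not2 H abG ax.
  exists (pos_lit (Lat a d)) => //=; rewrite !tsubst_Var; apply: ax.
  by apply: (@rank_U alpha b true a d); [split=> // -[]|].
- move=> b c G a d su dec not1 not2 H abG ax.
  exists (neg_lit (Lat a d)) => //=; rewrite !tsubst_Var; apply: ax.
  by apply: (@rank_U alpha b false a d); [split=> // -[]|].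
Qed.

Lemma holds_nnf_consistent (V : Set) (rho : V -> closed) A :
  (forall P, ~~ is_T P -> lt true P -> lt false P -> False) ->
  holds rho (nnf true A) -> holds rho (nnf false A) -> False.
Proof.
move=> lt_cons.
elim/formula_set_ind: A rho => {V} [V P|V A IH|V A IHA B IHB|V A IHA B IHB|V A IH] rho /=.
- case: P => [s t|t|t|t|e s t] h1 h2; try by apply: lt_cons h1 h2.
  by have /(val_T lt_val) := h2.
- by move=> h1 h2; apply: IH h2 h1.
- by move=> [hA hB] [/IHA|/IHB]; auto.
- by move=> h [/IHA hA /IHB hB]; case: h.
- by move=> h [c /IH]; auto.
Qed.

End Truth.

(** * Completeness *)

(** Finite approximations of the set of closed terms; at step n of a branch the existential
    sentences are instantiated with [terms n]. *)
Fixpoint terms (n : nat) : seq closed :=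
  if n is m.+1 then
    terms m ++ [seq a ∙ b | a <- terms m, b <- terms m]
  else map Cst [:: Ck; Cs; Cp; Cp0; Cp1; C0; CsN; CpN; CdN;
                   Ceq; Cneg; Cand; Cimp; Call; CN; CT; Cl].

Lemma In_allpairs (s : seq closed) a b :
  List.In a s -> List.In b s -> List.In (a ∙ b) [seq x ∙ y | x <- s, y <- s].
Proof.
move=> as_ bs; rewrite /allpairs_dep; elim: {1 3}s as_ => //= x r IH [->|/IH H].
  by apply/List.in_or_app; left; apply/List.in_map.
by apply/List.in_or_app; right.
Qed.

Lemma terms_mono m n a : m <= n -> List.In a (terms m) -> List.In a (terms n).
Proof.
move/subnKC <-; elim: (n - m) => [|k IH] H; first by rewrite addn0.
by rewrite addnS /=; apply/List.in_or_app; left; apply: IH.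
Qed.

Lemma terms_full (a : closed) : exists n, List.In a (terms n).
Proof.
elim: a => [[]|c|a [m Ha] b [n Hb]].
  by exists 0; case: c; rewrite /=; tauto.
exists (maxn m n).+1 => /=; apply/List.in_or_app; right.
by apply: In_allpairs; [apply: terms_mono Ha|apply: terms_mono Hb];
  rewrite ?leq_maxl ?leq_maxr.
Qed.

Section Completeness.
Variable D : sequent -> Prop.
Hypothesis D_closed : omega_closed D.
Hypothesis D_cons : forall t, D [:: pos_lit (AT t)] -> D [:: neg_lit (AT t)] -> False.

(** Sentences on a branch are meant to be false. One false conjunct or instance therefore suffices
    for a conjunction or a universal sentence, whereas disjunctions and existential sentences need
    all of theirs. *)
Definition handled (n : nat) (A : nf void) (G : sequent) : Prop :=
  match A with
  | Lit _ _ => True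
  | Conj A B => List.In A G \/ List.In B G
  | Disj A B => List.In A G /\ List.In B G
  | Univ A => exists c, List.In (inst A c) G
  | Exis A => forall c, List.In c (terms n) -> List.In (inst A c) G
  end.

Lemma handled_incl n A G G' :
  List.incl G G' -> handled n A G -> handled n A G'.
Proof.
move=> GG'; case: A => //= [A B|A B|A|A].
- by case=> /GG'; auto.
- by case=> /GG' ? /GG'.
- by case=> c /GG' ?; exists c.
- by move=> H c /H /GG'.
Qed.

Lemma mem_incl A G G' : List.incl G G' -> mem A G -> mem A G'.
Proof. by move=> GG' [B /GG' BG AB]; exists B. Qed.

Lemma handle n A G : mem A G -> ~ D G ->
  exists G', [/\ ~ D G', List.incl G G' & handled n A G'].
Proof.
have inclS (B : nf void) G0 : List.incl G0 (B :: G0) by apply: List.incl_tl; apply: List.incl_refl.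
case: A => [p P|A B|A B|A|A] AG nD.
- by exists G; split=> //; apply: List.incl_refl.
- case: (classic (D (A :: G))) => [DA|nA]; last first.
    by exists (A :: G); split=> //; left; left.
  exists (B :: G); split=> //; last by right; left.
  by move=> DB; apply: nD; apply: oc_Conj AG DA DB.
- have nA : ~ D (A :: G) by move=> DA; apply: nD; apply: oc_Disj0 AG DA.
  have nB : ~ D (B :: A :: G).
    move=> DB; apply: nA; apply: oc_Disj1 DB => //.
    by apply: mem_incl AG.
  exists (B :: A :: G); split=> //; first by do 2!apply: List.incl_tl; apply: List.incl_refl.
  by split; [right; left|left].
- have [c nc] : exists c, ~ D (inst A c :: G).
    apply: not_all_ex_not => H; apply: nD; exact: oc_Univ AG H.
  by exists (inst A c :: G); split=> //; exists c; left.
- rewrite /handled; elim: (terms n) => [|c s [G' [nD' GG' H]]].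
    by exists G; split=> // c [].
  exists (inst A c :: G'); split=> /=.
  + move=> Dc; apply: nD'; apply: oc_Exis Dc => //.
    exact: mem_incl GG' AG.
  + exact: List.incl_tran GG' (inclS _ _).
  + by move=> d [->|/H]; [left|right].
Qed.

Lemma handle_all n G : ~ D G -> exists G',
  [/\ ~ D G', List.incl G G' & forall A, List.In A G -> handled n A G'].
Proof.
move=> nD; suff: forall s, List.incl s G -> exists G',
    [/\ ~ D G', List.incl G G' & forall A, List.In A s -> handled n A G'].
  by apply; apply: List.incl_refl.
elim=> [|A s IH] sG; first by exists G; split=> //; apply: List.incl_refl.
have [|G' [nD' GG' H]] := IH; first by move=> B Bs; apply: sG; right.
have [|G'' [nD'' GG'' H']] := @handle n A G' _ nD'.
  by apply/mem_In/GG'/sG; left.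
exists G''; split=> //; first exact: List.incl_tran GG''.
by move=> B [<-//|/H]; apply: handled_incl.
Qed.

(* An underivable sequent is extended, fairly and without ever becoming
   derivable, to a set H of false sentences: a branch of the reduction tree. *)
Lemma underivable_branch G : ~ D G -> exists H : nat -> sequent,
  [/\ H 0 = G, forall n, ~ D (H n), forall n, List.incl (H n) (H n.+1)
    & forall n A, List.In A (H n) -> handled n A (H n.+1)].
Proof.
move=> nD.
have /choice [next Hnext] (x : nat * sequent) : exists G', ~ D x.2 ->
    [/\ ~ D G', List.incl x.2 G' & forall A, List.In A x.2 -> handled x.1 A G'].
  (* [G] is a default value for derivable sequents, which the branch never meets. *)
  case: (classic (D x.2)) => [|/(handle_all x.1) [G' HG']]; first by exists G.
  by exists G'.
pose H := fix H n := if n is m.+1 then next (m, H m) else G.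
have nDH n : ~ D (H n) by elim: n => //= n /(Hnext (n, _)) [].
by exists H; split=> // n; have [] := Hnext (n, H n) (nDH n).
Qed.

(** The branch of an underivable sequent yields a valuation refuting it. Requiring the valuations to
    agree with [D] on all literals other than [T] makes the consistency of derivable literals
    available when the lemma is applied. *)
Lemma complete G :
  (forall lt, valuation lt -> (forall p P, D [:: Lit p P] -> lt p P) ->
     (forall p P, ~~ is_T P -> lt p P -> D [:: Lit p P]) -> holds_seq lt G) ->
  D G.
Proof.
move=> valid; apply: NNPP => nD.
have [H [H0 nDH inclH handledH]] := underivable_branch nD.
have monoH m n : m <= n -> List.incl (H m) (H n).
  move/subnKC <-; elim: (n - m) => [|k IH]; first by rewrite addn0; apply: List.incl_refl.
  by rewrite addnS; apply: List.incl_tran IH (inclH _).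
pose false_in A := exists n, List.In A (H n).
have axH p P Q : aconv P Q -> D [:: Lit p P] -> ~ false_in (Lit p Q).
  move=> PQ DP [n Hn]; apply: (nDH n); apply: oc_sub DP => // A /mem1 AP.
  by exists (Lit p Q) => //; apply: nconv_trans AP _; constructor.
have D_aconv p P Q : aconv P Q -> D [:: Lit p P] -> D [:: Lit p Q].
  by move=> PQ; apply: oc_sub => //; apply/subq1; constructor.
(* [T t] is false unless forced to be true by a derivation or by some [~ T t'] on the branch, which
   has to fail. A derivable literal cannot lie on the branch, and Log keeps [T t] and [~ T t'] from
   both lying on it. *)
pose true_T t := D [:: pos_lit (AT t)] \/
  exists2 t', conv t t' & false_in (neg_lit (AT t')).
pose lt p (P : atom true void) : Prop :=
  match P with
  | AT t => if p then true_T t else ~ true_T t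
  | _ => D [:: Lit p P]
  end.
have true_T_conv s t : conv s t -> true_T s -> true_T t.
  move=> st [Ds|[t' st' Ht']]; [left|right].
    by apply: D_aconv Ds; constructor.
  by exists t' => //; apply: conv_trans (conv_sym st) st'.
have lt_val : valuation lt.
  split=> // p P Q PQ; have HD := D_aconv p _ _ PQ; case: PQ HD => //= t t' tt' _.
  case: p; first exact: true_T_conv.
  by apply: contra_not; apply: true_T_conv; apply: conv_sym.
have lt_D p P : D [:: Lit p P] -> lt p P.
  case: P => //= t; case: p => [|Dt]; first by left.
  case=> [/D_cons|[t' tt' Ht']]; first exact.
  by apply: axH Ht'; [constructor; exact: tt'|].
have lit_false p P : false_in (Lit p P) -> ~ lt p P.
  case: P => [s t|t|t|t|e s t] /= HP; try by move/axH; apply; eauto.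
  case: p HP => HP; last by apply; right; exists t.
  case=> [Dt|[t' tt' [n Hn]]]; first exact: axH Dt HP.
  have [m Hm] := HP; apply: (nDH (maxn m n)); apply: (@oc_Log _ D_closed _ t).
    by apply: mem_In; apply: monoH Hm; rewrite leq_maxl.
  exists (neg_lit (AT t')); last by do 2!constructor.
  by apply: monoH Hn; rewrite leq_maxr.
have falsified (V : Set) (A : nf V) rho : false_in (nsubst rho A) -> ~ holds lt rho A.
  elim/nf_set_ind: A rho => {V} [V p P|V A IHA B IHB|V A IHA B IHB|V A IH|V A IH] rho /=.
  - exact: lit_false.
  - by move=> [n /handledH /= [H'|H']] [hA hB]; [apply: IHA hA|apply: IHB hB]; exists n.+1.
  - move=> [n /handledH /= [HA HB]] [hA|hB]; [apply: IHA hA|apply: IHB hB]; by exists n.+1.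
  - move=> [n /handledH /= [c Hc]] /(_ c); apply: IH; exists n.+1.
    by rewrite -inst_nsubst.
  (* The term [c] is listed from step [m] on and the existential sentence is present from step [n]
     on, so this instance is added right after step [maxn m n]. *)
  - move=> [n Hn] [c]; have [m Hm] := terms_full c.
    have {Hn} /handledH /= Hn : List.In (Exis (nsubst (up rho) A)) (H (maxn m n)).
      by apply: monoH Hn; rewrite leq_maxr.
    apply: IH; exists (maxn m n).+1; rewrite -inst_nsubst; apply: Hn.
    by apply: terms_mono Hm; rewrite leq_maxl.
have [|A [B BG AB] hA] := valid lt lt_val lt_D; first by move=> p [].
case: (@falsified void B Var); last exact: holds_nconv hA.
by rewrite nsubst_Var; exists 0; rewrite H0.
Qed.

End Completeness.

(** * Consistency *)

Lemma nonT_consistent alpha beta alpha' beta' P : ~~ is_T P ->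
  deriv_rank alpha beta [:: Lit true P] ->
  deriv_rank alpha' beta' [:: Lit false P] -> False.
Proof.
case: P => //= [s t|t|t|e s t] _ /lit_inv /= H1 /lit_inv /= H2 //.
by case: H1 H2 => a1 _ H1 [a2 _ H2]; apply: decides_consistent H1 H2.
Qed.

(** Let literals be true when derivable, and let [T t] be false otherwise. By [T_cons] this respects
    the derivable negated [T]-literals, and soundness would make both [A] and its negation true. *)
Lemma rank_consistent alpha beta :
  (forall t, deriv_rank alpha beta [:: pos_lit (AT t)] ->
     deriv_rank alpha beta [:: neg_lit (AT t)] -> False) ->
  forall A : formula true void, deriv_rank alpha beta [:: nnf true A] ->
    deriv_rank alpha beta [:: nnf false A] -> False.
Proof.
move=> T_cons A.
pose lt p (P : atom true void) : Prop :=
  match P with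
  | AT t => if p then deriv_rank alpha beta [:: pos_lit (AT t)]
            else ~ deriv_rank alpha beta [:: pos_lit (AT t)]
  | _ => deriv_rank alpha beta [:: Lit p P]
  end.
have D_aconv p P Q : aconv P Q -> deriv_rank alpha beta [:: Lit p P] ->
    deriv_rank alpha beta [:: Lit p Q].
  by move=> PQ; apply/deriv_rank_sub/subq1; constructor.
have lt_val : valuation lt.
  split=> // p P Q PQ; have HD r := D_aconv r _ _ PQ.
  have HD' := D_aconv true _ _ (aconv_sym PQ).
  case: PQ HD HD' => [s s' u u' _ _|u u' _|u u' _|u u' _|e e' s s' u u' _ _] /= HD HD';
    try exact: HD.
  by case: p; [exact: HD|exact: contra_not HD'].
have lt_D p P : deriv_rank alpha beta [:: Lit p P] -> lt p P.
  by case: P => //= t; case: p => // Dt /T_cons; apply.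
move=> /(sound lt_val lt_D)/(holds_seq1 lt_val) h1.
move=> /(sound lt_val lt_D)/(holds_seq1 lt_val).
apply: (holds_nnf_consistent lt_val) h1 => -[] //= *;
  by apply: nonT_consistent; try eassumption.
Qed.

Lemma deriv_T_consistent alpha beta t : deriv_rank alpha beta [:: pos_lit (AT t)] ->
  deriv_rank alpha beta [:: neg_lit (AT t)] -> False.
Proof.
elim/(well_founded_ind olt_wf): alpha beta t => alpha IHa.
elim/(well_founded_ind olt_wf) => beta IHb t.
move=> /lit_inv [A ctA HA] /lit_inv [B ctB HB].
have {}HB : deriv_lt alpha [:: nnf false A] \/
    exists2 b, olt b beta & deriv_rank alpha b [:: nnf false A].
  have S : subq [:: nnf false B] [:: nnf false A] by apply/subq1/(codes_inj _ ctB ctA).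
  case: HB => [/(deriv_lt_sub S)|[b lt_b /(deriv_rank_sub S)]]; first by left.
  by right; exists b.
(* The larger of two ranks below [beta] is one of them, hence still below [beta], so [IHb] applies
   to it. *)
have caseb b b' : olt b beta -> olt b' beta ->
    deriv_rank alpha b [:: nnf true A] -> deriv_rank alpha b' [:: nnf false A] -> False.
  move=> lt_b lt_b' H1 H2; have [c [le1 le2 cE]] := omax b b'.
  apply: (@rank_consistent alpha c _ A).
  - by apply: IHb; case: cE => ->.
  - exact: deriv_rank_mono le1 H1.
  - exact: deriv_rank_mono le2 H2.
case: HA HB => [HA|[b lt_b HA]] [HB|[b' lt_b' HB]].
(* Here the stage drops, so the common rank [d] may be arbitrary. *)
- case: HA HB => a [lt_a [b HA]] [a' [lt_a' [b' HB]]].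
  have [c [le1 le2 cE]] := omax a a'; have [d [le1' le2' _]] := omax b b'.
  apply: (@rank_consistent c d _ A).
  + by move=> s; apply: IHa; case: cE => ->.
  + exact: deriv_rank_mono le1' (deriv_rank_stage_mono le1 HA).
  + exact: deriv_rank_mono le2' (deriv_rank_stage_mono le2 HB).
(* In the mixed cases Weak gives the derivation from an earlier stage the rank of the other one. *)
- by apply: (caseb _ _ lt_b' lt_b' _ HB); apply: deriv_rank_weak.
- by apply: (caseb _ _ lt_b lt_b HA _); apply: deriv_rank_weak.
- exact: caseb lt_b lt_b' HA HB.
Qed.

Lemma deriv_consistent alpha alpha' A :
  deriv alpha [:: nnf true A] -> deriv alpha' [:: nnf false A] -> False.
Proof.
move=> [b H] [b' H'].
have [a [le1 le2 _]] := omax alpha alpha'; have [c [le1' le2' _]] := omax b b'.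
apply: (@rank_consistent a c _ A).
- exact: deriv_T_consistent.
- exact: deriv_rank_mono le1' (deriv_rank_stage_mono le1 H).
- exact: deriv_rank_mono le2' (deriv_rank_stage_mono le2 H').
Qed.

Lemma on_term_consistent alpha alpha' t :
  on_term (deriv alpha) t -> on_term (deriv alpha') (Cst Cneg ∙ t) -> False.
Proof.
move=> [A ct HA] [B /codes_neg [A' ct' ->] HB].
apply: deriv_consistent HA _; apply: deriv_sub HB.
exact/subq1/(codes_inj _ ct' ct).
Qed.

Lemma deriv_complete alpha G :
  (forall lt, valuation lt -> (forall p P, deriv alpha [:: Lit p P] -> lt p P) ->
     (forall p P, ~~ is_T P -> lt p P -> deriv alpha [:: Lit p P]) ->
     holds_seq lt G) ->
  deriv alpha G.
Proof.
apply: complete; first exact: deriv_omega_closed.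
move=> t H; apply: (@deriv_consistent _ _ (Atom (AT t))) H.
Qed.

Lemma deriv_sound alpha lt G : valuation lt ->
  (forall p P, deriv alpha [:: Lit p P] -> lt p P) ->
  deriv alpha G -> holds_seq lt G.
Proof.
by move=> lt_val ax [b]; apply: sound => // p P H; apply: ax; exists b.
Qed.

Lemma deriv_mp alpha A B : deriv alpha [:: nnf true (Imp A B)] ->
  deriv alpha [:: nnf true A] -> deriv alpha [:: nnf true B].
Proof.
move=> HAB HA; apply: deriv_complete => lt lt_val ax nonT.
exists (nnf true B) => //.
have := holds_seq1 lt_val (deriv_sound lt_val ax HA).
have /= [] := holds_seq1 lt_val (deriv_sound lt_val ax HAB) => // hA hA'.
case: (holds_nnf_consistent lt_val _ hA' hA) => P nT h1 h2.
have [b1 H1] := nonT _ _ nT h1; have [b2 H2] := nonT _ _ nT h2; exact: nonT_consistent H1 H2.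
Qed.

(** * Universes *)

Lemma on_derivable t :
  on_term derivable t -> exists alpha, on_term (deriv alpha) t.
Proof. by case=> A ct [alpha H]; exists alpha, A. Qed.

Lemma derivable_on alpha t : on_term (deriv alpha) t -> on_term derivable t.
Proof. by apply: on_term_sub => G H; exists alpha. Qed.

Lemma on_term_L (D : sequent -> Prop) a x :
  D [:: pos_lit (Lat a x)] -> on_term D (Cst Cl ∙ a ∙ x).
Proof. by move=> H; exists (Atom (Lat a x)) => //; exists (Cst Cl ∙ a ∙ x). Qed.

Lemma on_term_negL (D : sequent -> Prop) a x :
  D [:: neg_lit (Lat a x)] -> on_term D (Cst Cneg ∙ (Cst Cl ∙ a ∙ x)).
Proof.
by move=> H; exists (Neg (Atom (Lat a x))) => //; exists (Cst Cneg ∙ (Cst Cl ∙ a ∙ x)).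
Qed.

(** Each value is decided at some chosen stage, and the supremum over all closed terms bounds these
    stages. *)
Lemma decided_stage a : decided derivable a ->
  exists alpha, decided (deriv alpha) a.
Proof.
move=> dec.
have /choice [f Hf] (c : closed) : exists alpha,
    on_term (deriv alpha) (a ∙ c) \/ on_term (deriv alpha) (Cst Cneg ∙ (a ∙ c)).
  by case: (dec c) => /on_derivable [alpha H]; exists alpha; auto.
exists (osup f) => c; have le_c : ole (f c) (osup f) by apply/oltW/olt_osup.
by case: (Hf c) => H; [left|right]; apply: on_term_sub H => G; apply: deriv_mono.
Qed.

Lemma universe_stage a : decided derivable a -> exists beta,
  [/\ decided (deriv beta) a,
      forall x, on_term derivable (Cst Cl ∙ a ∙ x) <-> on_term (deriv beta) x
    & forall x, on_term derivable (Cst Cl ∙ a ∙ x) \/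
                on_term derivable (Cst Cneg ∙ (Cst Cl ∙ a ∙ x))].
Proof.
move=> /decided_stage [alpha0 dec0].
(* [P] collects the side conditions of the rules for [L_a] that do not mention the second argument;
   at its least solution all literals [L_a(x)] are decided at once. *)
pose P alpha := is_succ alpha /\ decided (deriv_lt alpha) a.
have [|alpha [[beta [le1 le2]] dec] min] := @olt_min P (osucc alpha0).
  split; first by exists alpha0.
  by move=> c; case: (dec0 c) => H; [left|right]; apply: on_term_sub H => G;
    rewrite deriv_ltE.
have ltE t : on_term (deriv_lt alpha) t <-> on_term (deriv beta) t.
  split; apply: on_term_sub => G.
    by move/(deriv_lt_mono le1); rewrite deriv_ltE.
  by rewrite -deriv_ltE; apply: deriv_lt_mono.
have L_inv alpha' p x : deriv alpha' [:: Lit p (Lat a x)] ->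
    exists2 alpha'', ole alpha'' alpha' & decides alpha'' p a x.
  by case=> b /lit_inv.
(* An earlier literal would stem from an application of these rules at a smaller stage satisfying
   [P]. *)
have no p x : ~ deriv_lt alpha [:: Lit p (Lat a x)].
  move=> [alpha' [lt_a /L_inv [alpha'' le_a [su dec' _ _]]]].
  by apply: (min alpha''); [apply: ole_olt_trans le_a lt_a|].
have decT x : on_term (deriv_lt alpha) x -> decides alpha true a x.
  by split=> //; exists beta.
have decF x : ~ on_term (deriv_lt alpha) x -> decides alpha false a x.
  by split=> //; exists beta.
have posL x : on_term (deriv_lt alpha) x -> on_term derivable (Cst Cl ∙ a ∙ x).
  by move/decT/decides_deriv => H; apply: (@derivable_on alpha); apply: on_term_L.
exists beta; split.
- by move=> c; rewrite -!ltE; apply: dec.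
- move=> x; rewrite -ltE; split=> [/on_derivable [alpha' H]|]; last exact: posL.
  (* If [x] were underivable at [beta], the negative literal would be decided at [alpha], against
     the positive one just assumed derivable. *)
  apply: NNPP => /decF H'.
  have codesL : codes (Cst Cl ∙ a ∙ x) (Atom (Lat a x)) by exists (Cst Cl ∙ a ∙ x).
  have /L_inv [alpha'' _ H''] := proj1 (on_term_codes _ codesL) H.
  exact: decides_consistent H'' H'.
- move=> x; case: (classic (on_term (deriv_lt alpha) x)) => [/posL|/decF H]; first by left.
  right; apply: (@derivable_on alpha); apply: on_term_negL.
  exact: decides_deriv H.
Qed.

Lemma universe u : @IU M_VFU u -> exists beta,
  (forall x, on_term derivable (u ∙ x) <-> on_term (deriv beta) x) /\
  (forall x, on_term derivable (u ∙ x) \/ on_term derivable (Cst Cneg ∙ (u ∙ x))).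
Proof.
move=> [a ua /universe_stage [beta [_ H1 H2]]]; exists beta.
have uax x : conv (u ∙ x) (Cst Cl ∙ a ∙ x) by apply: conv_app.
split=> x.
  rewrite -H1; split; apply: on_term_conv; first exact: uax.
  exact: conv_sym.
by case: (H2 x) => H; [left|right]; apply: on_term_conv H; rewrite -/(conv _ _);
  do ?apply: conv_app => //; apply: conv_sym.
Qed.

(** * Satisfaction in term models *)

Definition extend_atom V (P : atom false V) : atom true V :=
  match P with
  | AEq s t => AEq s t
  | AN t => AN t
  | AT t => AT t
  | AU t => AU t
  | AL _ s t => AL (isT : is_true true) s t
  end.

Fixpoint extend (V : Type) (A : formula false V) : formula true V :=
  match A with
  | Atom P => Atom (extend_atom P)
  | Neg A => Neg (extend A)
  | And A B => And (extend A) (extend B)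
  | Imp A B => Imp (extend A) (extend B)
  | All A => All (extend A)
  end.

Lemma dot_extend (V : Set) (A : formula false V) : dot (extend A) = dot A.
Proof.
by elim/formula_set_ind: A => {V} [V []|V A /= ->|V A /= -> B ->|V A /= -> B ->|V A /= ->].
Qed.

Lemma codes_fsubst (V : Set) (rho : V -> closed) (A : formula false V) a :
  dot A = Some a -> codes (tsubst rho a) (fsubst rho (extend A)).
Proof. by move=> E; exists (tsubst rho a); rewrite // dot_fsubst dot_extend E. Qed.

Lemma on_term_dot alpha (V : Set) (rho : V -> closed) (A : formula false V) a :
  dot A = Some a -> on_term (deriv alpha) (tsubst rho a) <->
    deriv alpha [:: nsubst rho (nnf true (extend A))].
Proof. by move=> /(codes_fsubst rho)/on_term_codes ->; rewrite nnf_fsubst. Qed.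

(** [T] and [U] are left open so that [T] can be read off from a valuation as well as from
    derivability. *)
Definition term_model (T U : closed -> Prop) : structure := {|
  dom := closed; Icst := @Cst void; Iapp := @App void; Ieq := @conv void;
  IN := @is_nat void; IT := T; IU := U |}.

Lemma term_model_identity T U :
  (forall s t, conv s t -> T s -> T t) -> (forall s t, conv s t -> U s -> U t) ->
  identity_axioms (term_model T U).
Proof.
split=> //=; [exact: conv_sym|exact: conv_trans|exact: conv_app|].
exact: is_nat_conv.
Qed.

Lemma eval_term_model T U V (rho : V -> closed) t :
  @eval (term_model T U) V rho t = tsubst rho t.
Proof. by elim: t => //= a -> b ->. Qed.

Lemma eval_M_VFU V (rho : V -> closed) t : @eval M_VFU V rho t = tsubst rho t.
Proof. exact: eval_term_model. Qed.

(** Both signs go together because negation exchanges them. Having a dotted term excludes [U], about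
    which nothing is assumed of [lt]. *)
Lemma holds_of_sat lt T U (V : Set) (rho : V -> closed) A a : dot A = Some a ->
  (forall p P, CTT_true p P -> lt p P) ->
  (forall t, T t -> lt true (AT t)) -> (forall t, ~ T t -> lt false (AT t)) ->
  (@sat (term_model T U) V rho A -> holds lt rho (nnf true (extend A))) /\
  (~ @sat (term_model T U) V rho A -> holds lt rho (nnf false (extend A))).
Proof.
move=> dotA ltC ltT ltF.
elim/formula_set_ind: A a rho dotA => {V} [V P|V A IH|V A IHA B IHB|V A IHA B IHB|V A IH] a rho.
- case: P => [s t|t|t|t|//] //= _; rewrite !eval_term_model.
  + by split=> H; apply: ltC.
  + by split=> H; apply: ltC.
  + by split; auto.
- rewrite /=; case E: dot => [b|] //= _; have [h1 h2] := IH _ rho E.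
  by split=> // /NNPP.
- rewrite /=; case E: dot => [b|] //=; case E': dot => [c|] //= _.
  have [hA1 hA2] := IHA _ rho E; have [hB1 hB2] := IHB _ rho E'.
  split; first by case; auto.
  by case/not_and_or => H; [left; apply: hA2|right; apply: hB2].
- rewrite /=; case E: dot => [b|] //=; case E': dot => [c|] //= _.
  have [hA1 hA2] := IHA _ rho E; have [hB1 hB2] := IHB _ rho E'.
  split; first by move/imply_to_or => [H|H]; [left; apply: hA2|right; apply: hB1].
  by move=> H; have [/hA1 ? /hB2] := imply_to_and _ _ H.
- rewrite /=; case E: dot => [b|] //= _; split=> [H c|/not_all_ex_not [c H]].
    by have [h1 _] := IH _ (oapp rho c) E; apply/h1/H.
  by exists c; have [_ h2] := IH _ (oapp rho c) E; apply: h2.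
Qed.

Lemma deriv_valid alpha (C : formula false nat) c rho :
  logically_valid C -> dot C = Some c ->
  deriv alpha [:: nsubst rho (nnf true (extend C))].
Proof.
move=> valid E; apply: deriv_complete => lt lt_val ax _.
exists (nsubst rho (nnf true (extend C))) => //; apply/holds_nsubst.
have -> : (fun v => tsubst Var (rho v)) = rho.
  by apply: functional_extensionality => v; apply: tsubst_Var.
(* The valuation turns the term model into an ordinary structure, to which validity applies. The
   empty [U] is an arbitrary choice, as [C] has a dotted term. *)
pose T t := lt true (AT t).
have := @holds_of_sat lt T (fun _ => False) nat rho C c E.
case=> //.
- move=> p P HP; apply: ax; exists (osucc alpha); apply: rank_Lit HP _.
  exact: mem_head.
- by move=> t H; apply/(val_T lt_val).
- move=> + _; apply; apply: valid; apply: term_model_identity => // s t st.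
  by apply: val_aconv => //; constructor.
Qed.

(** The valuation reads [T] as derivability at any stage and takes the other literals from stage
    [alpha]. Soundness makes [A] true in it, while failure of [A] in the model would make its
    negation true. *)
Lemma deriv_true alpha (A : formula false nat) a rho : dot A = Some a ->
  deriv alpha [:: nsubst rho (nnf true (extend A))] -> @sat M_VFU nat rho A.
Proof.
move=> E HA; apply: NNPP => nsat.
pose lt p (P : atom true void) : Prop :=
  match P with
  | AT t => if p then on_term derivable t else ~ on_term derivable t
  | _ => deriv alpha [:: Lit p P]
  end.
have lt_val : valuation lt.
  split=> // p P Q PQ.
  have HD : deriv alpha [:: Lit p P] -> deriv alpha [:: Lit p Q].
    by apply/deriv_sub/subq1; constructor.
  case: PQ HD => [s s' u u' _ _|u u' _|u u' uu'|u u' _|e e' s s' u u' _ _] //= _.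
  case: p; first exact: on_term_conv.
  by apply: contra_not; apply: on_term_conv; apply: conv_sym.
have ax p P : deriv alpha [:: Lit p P] -> lt p P.
  case: P => //= t /lit_inv_T [B ct]; case: p => HB.
    by apply: (@derivable_on alpha); exists B.
  (* If [~ T t] is derivable, so is the negation of the coded sentence, and by consistency the
     sentence is derivable at no stage. *)
  move/on_derivable => [alpha' /(on_term_codes _ ct)] HB'.
  exact: deriv_consistent HB' HB.
have /(holds_seq1 lt_val)/holds_nsubst h1 := deriv_sound lt_val ax HA.
have Erho : (fun v => tsubst Var (rho v)) = rho.
  by apply: functional_extensionality => v; apply: tsubst_Var.
rewrite Erho in h1.
have [||//|_ /(_ nsat) h2] := @holds_of_sat lt (on_term derivable) (@IU M_VFU) nat rho A a E.
- move=> p P HP; apply: ax; exists (osucc alpha); apply: rank_Lit HP _.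
  exact: mem_head.
- by [].
- apply: (holds_nnf_consistent lt_val) h1 h2 => P nT.
  case: P nT => [s t|t|t|t|e s t] //= nT [b1 H1] [b2 H2];
  exact: nonT_consistent H1 H2.
Qed.

(** * The applicative axioms *)

Lemma eval_tsubst (M : structure) V W (f : V -> term W) (rho : W -> M) t :
  eval rho (tsubst f t) = eval (fun v => eval rho (f v)) t.
Proof. by elim: t => //= a -> b ->. Qed.

Lemma sat_fsubst (M : structure) (V W : Set) (f : V -> term W) (rho : W -> M) A :
  sat rho (fsubst f A) <-> sat (fun v => eval rho (f v)) A.
Proof.
elim/formula_set_ind: A W f rho => {V} [V P|V A IH|V A IHA B IHB|V A IHA B IHB|V A IH] W f rho /=.
- by case: P => [s t|t|t|t|//] /=; rewrite !eval_tsubst.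
- by rewrite IH.
- by rewrite IHA IHB.
- by rewrite IHA IHB.
- have E d : (fun v => eval (oapp rho d) (up f v)) = oapp (fun v => eval rho (f v)) d.
    by apply: functional_extensionality => -[v|] //=; rewrite eval_tsubst.
  by split=> H d; have := H d; rewrite IH E.
Qed.

Lemma eval_Ieq (M : structure) V (rho rho' : V -> M) t : identity_axioms M ->
  (forall v, Ieq (rho v) (rho' v)) -> Ieq (eval rho t) (eval rho' t).
Proof.
move=> M_id rr'; elim: t => [v|c|a IHa b IHb] //=; first exact: Ieq_refl.
exact: Ieq_app.
Qed.

(** Equality is a congruence and not the identity. Induction on numbers needs this, since a natural
    number of the model is only convertible to a numeral. *)
Lemma sat_Ieq (M : structure) (V : Set) (rho rho' : V -> M) A :
  identity_axioms M -> (forall v, Ieq (rho v) (rho' v)) ->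
  sat rho A <-> sat rho' A.
Proof.
move=> M_id; elim/formula_set_ind: A rho rho' => {V}
    [V P|V A IH|V A IHA B IHB|V A IHA B IHB|V A IH] rho rho' rr' /=.
- have E t : Ieq (eval rho t) (eval rho' t) by apply: eval_Ieq.
  have E' t : Ieq (eval rho' t) (eval rho t) by apply: Ieq_sym.
  case: P => [s t|t|t|t|//] /=.
  + split=> H.
      exact: (Ieq_trans M_id (E' s) (Ieq_trans M_id H (E t))).
    exact: (Ieq_trans M_id (E s) (Ieq_trans M_id H (E' t))).
  + by split; apply: Ieq_N.
  + by split; apply: Ieq_T.
  + by split; apply: Ieq_U.
- by rewrite (IH _ _ rr').
- by rewrite (IHA _ _ rr') (IHB _ _ rr').
- by rewrite (IHA _ _ rr') (IHB _ _ rr').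
- have rr'' d v : Ieq (oapp rho d v) (oapp rho' d v).
    by case: v => //=; apply: Ieq_refl.
  by split=> H d; apply/(IH _ _ (rr'' d)).
Qed.

Lemma M_VFU_identity : identity_axioms M_VFU.
Proof.
apply: term_model_identity => s t st; first exact: on_term_conv.
by case=> a sa; exists a => //; apply: conv_trans (conv_sym st) sa.
Qed.

Lemma is_nat_0 V : is_nat (numeral V 0).
Proof. by exists 0; apply: rt_refl. Qed.

Lemma is_nat_S V (x : term V) : is_nat x -> is_nat (Cst CsN ∙ x).
Proof. by case=> n xn; exists n.+1; apply: reduces_app => //; apply: rt_refl. Qed.

Lemma TON_sound A rho : TON A -> @sat M_VFU nat rho A.
Proof.
have C := step_conv.
case=> {A} /=.
- by move=> x y; apply/C/step_k.
- by move=> x y z; apply/C/step_s.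
- by move=> x y; split; apply: C; [apply: step_p0|apply: step_p1].
- by move=> x; split; [apply: is_nat_0|apply: is_nat_S].
- move=> x [n /reduces_conv xn]; split.
    move=> H; have : conv (numeral void n.+1) (numeral void 0).
      by apply: conv_trans H; apply: conv_app => //; apply: conv_sym.
    by move/conv_numeral.
  apply: conv_trans (conv_sym xn); apply: conv_trans (C _ _ _ (step_pN _ n)).
  by do 2!apply: conv_app => //.
- move=> x [[[|n] /reduces_conv xn] nx]; first by case: nx.
  have px : conv (Cst CpN ∙ rho x) (numeral void n).
    by apply: conv_trans (C _ _ _ (step_pN _ n)); apply: conv_app.
  split; first by apply: is_nat_conv (conv_sym px) _; exists n; apply: rt_refl.
  by apply: conv_trans (conv_sym xn); apply: conv_app.
- move=> x y a b [[n /reduces_conv an] [_ ab]].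
  apply: conv_trans (C _ _ _ (step_dN_eq _ _ n)).
  apply: conv_app; first exact: conv_app.
  by apply: conv_trans an; apply: conv_sym.
- move=> x y a b [[m /reduces_conv am] [[n /reduces_conv bn] ab]].
  have neq : m <> n.
    by move=> ?; subst n; apply: ab; apply: conv_trans am (conv_sym bn).
  apply: conv_trans (C _ _ _ (step_dN_neq _ _ neq)).
  by apply: conv_app => //; apply: conv_app.
- move=> B [/sat_fsubst H0 HS] d [n /reduces_conv dn].
  have conv_oapp (c c' : closed) : conv c c' -> forall v : option nat, conv (oapp rho c v) (oapp rho c' v).
    by move=> cc' [v|].
  have E (c : closed) (f : option nat -> term (option nat)) (g : closed) :
      (fun v => eval (oapp rho c) (f v)) = oapp rho g ->
      @sat M_VFU _ (oapp rho c) (fsubst f B) -> @sat M_VFU _ (oapp rho g) B.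
    by move=> <- /sat_fsubst.
  (* Induction over the standard numerals; the result is then carried over to the convertible term
     [d]. *)
  have Hn : @sat M_VFU _ (oapp rho (numeral void n)) B.
    elim: n {dn} => [|n IH].
      have <- // : (fun v => @eval M_VFU _ rho (@subst_zero nat v)) =
          oapp rho (numeral void 0).
      by apply: functional_extensionality; case.
    apply: (@E (numeral void n) (@subst_succ nat)).
      by apply: functional_extensionality => -[v|].
    by apply: HS; split=> //; exists n; apply: rt_refl.
  apply/(sat_Ieq _ M_VFU_identity (conv_oapp _ _ dn)); exact: Hn.
Qed.

(** * The axioms for universes *)

(** The rules for [T] raise the rank but not the stage, so a whole stage, with all its ranks, is
    closed under them in both directions. *)
Lemma on_term_T alpha t :
  on_term (deriv alpha) t <-> on_term (deriv alpha) (Cst CT ∙ t).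
Proof.
have ct : codes (Cst CT ∙ t) (Atom (AT t)) by exists (Cst CT ∙ t).
rewrite (on_term_codes _ ct); split=> [[A cA HA]|/lit_inv_T [A cA HA]].
  exact: deriv_T cA HA.
by exists A.
Qed.

Lemma on_term_negT alpha t :
  on_term (deriv alpha) (Cst Cneg ∙ t) <->
  on_term (deriv alpha) (Cst Cneg ∙ (Cst CT ∙ t)).
Proof.
have ct : codes (Cst CT ∙ t) (Atom (AT t)) by exists (Cst CT ∙ t).
rewrite (on_term_codes _ (codes_Neg ct)) /=.
split=> [[B /codes_neg [A cA ->] HA]|/lit_inv_T [A cA HA]].
  exact: deriv_T cA HA.
by exists (Neg A) => //; apply: codes_Neg.
Qed.

Lemma literal_deriv alpha (P : formula false nat) (rho : nat -> closed) :
  L_literal P -> @sat M_VFU nat rho P ->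
  deriv alpha [:: nsubst rho (nnf true (extend P))].
Proof.
have H p Q : CTT_true p Q -> deriv alpha [:: Lit p Q].
  by move=> HQ; exists (osucc alpha); apply: rank_Lit HQ _; apply: mem_head.
by case: P => [[s t|t|t|t|//]|[[s t|t|t|t|//]|A|A B|A B|A]|A B|A B|A] //= _;
  rewrite !eval_M_VFU => HP; apply: H.
Qed.

Lemma VFU_sound A rho : VFU A -> @sat M_VFU nat rho A.
Proof.
case=> {A}.
- by move=> A; apply: TON_sound.
- move=> u A a E /= /universe [b [ub _]]; rewrite eval_M_VFU ub.
  by move/(on_term_dot b rho E); apply: deriv_true E.
- move=> u P p lit E /= /universe [b [ub _]] HP; rewrite eval_M_VFU ub.
  by apply/(on_term_dot b rho E)/literal_deriv.
- move=> u A B a b i Ea Eb Ei /= /universe [al [ub _]].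
  rewrite !eval_M_VFU !ub (on_term_dot _ _ Ea) (on_term_dot _ _ Eb) (on_term_dot _ _ Ei).
  rewrite -!nnf_fsubst => HAB HA; exact: deriv_mp HAB HA.
- move=> u A a q Ea Eq /= /universe [b [ub _]] HA.
  rewrite eval_M_VFU ub (on_term_dot _ _ Eq) /=.
  apply: (oc_Univ (deriv_omega_closed b) (mem_head _ _)) => c.
  rewrite inst_nsubst; have := HA c; rewrite eval_M_VFU /= ub (on_term_dot _ _ Ea).
  (* The omega-rule repeats its principal sentence in the premises, hence the weakening. *)
  by apply: deriv_sub => B; apply: mem_incl => C [->|[]]; left.
- move=> u C c valid E /= /universe [b [ub _]]; rewrite eval_M_VFU ub (on_term_dot _ _ E).
  exact: deriv_valid E.
- move=> u x /= /universe [b [ub _]]; rewrite !ub => -[].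
  exact: on_term_consistent.
- move=> u x /= /universe [b [ub _]]; rewrite !ub.
  by have [? ?] := on_term_T b (rho x); have [? ?] := on_term_negT b (rho x).
- move=> u /= /universe [b [_ tot]] d [h1 h2].
  by case: (tot d).
- move=> u x /= /universe [b [ub _]]; rewrite ub; exact: derivable_on.
- move=> f /= tot.
  have dec : decided derivable (rho f).
    by move=> c; apply: NNPP => /not_or_and; apply: tot.
  split; first by exists (rho f).
  have [b [decb ub _]] := universe_stage dec.
  (* Stage [b] decides every value of the class. The decision opposite to [H] is impossible, since
     derivations at different stages are consistent with each other. *)
  split=> d H; rewrite ub; case: (decb d) => // H'.
    by have [a H''] := on_derivable H; case: (on_term_consistent H'' H').
  by have [a H''] := on_derivable H; case: (on_term_consistent H' H'').
Qed.

Theorem theorem7p16 : is_model M_VFU VFU.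
Proof.
split; first exact: M_VFU_identity.
by move=> A HA rho; apply: VFU_sound.
Qed.
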